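(* Let $n\geq 2$ be an integer and let $\mathbb{F}_q$ be a finite field with $q$ elements. (a) If $\mathbb{F}_q$ has odd characteristic $p$, then $\mathrm{PGL}_n(\mathbb{F}_q)$ has connected reduced power graph if and only if $n$ is not a prime and $n>p$. (b) If $\mathbb{F}_q$ has characteristic $2$ and $q\neq 2$, then $\mathrm{PGL}_n(\mathbb{F}_q)$ has connected reduced power graph if and only if $n$ is not a prime, $n>2$, and either $q-1$ is not prime or $n\geq q$. (c) $\mathrm{PGL}_n(\mathbb{F}_2)$ has disconnected reduced power graph if and only if at least one of the following three situations occurs: (1) $n$ or $n-1$ is prime; (2) $n$ has a prime factor $p_1$ such that $p_0=2^{p_1}-1$ is also a prime and $n\leq 2^{p_1}-2$; (3) $n-1$ has a prime factor $p_1$ such that $p_0=2^{p_1}-1$ is also a prime and $n\leq 2^{p_1}-1$.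
   Context: For a group $G$, the (undirected) power graph of $G$ has vertex set $G$, with two distinct vertices $g,h$ joined by an edge if and only if one of them is a power of the other. The reduced power graph of $G$ is obtained from the power graph by deleting the identity element. $\mathrm{PGL}_n(\mathbb{F}_q)=\mathrm{GL}_n(\mathbb{F}_q)/Z(\mathrm{GL}_n(\mathbb{F}_q))$, where the center consists of the nonzero scalar multiples of the identity matrix. *)

(* Defs.v *)
From HB Require Import structures.
From mathcomp Require Import all_boot all_order all_algebra all_fingroup.
From mathcomp Require Import all_solvable.

Set Implicit Arguments.
Unset Strict Implicit.
Unset Printing Implicit Defensive.

Import GroupScope.

(* In a finite group the (integer or natural) powers of [h] are exactly the
   elements of [<[h]>]. *)
Definition power_adj (gT : finGroupType) : rel gT :=
  fun g h => (g != h) && ((g \in <[h]>) || (h \in <[g]>)).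

Definition induced_rel (T : finType) (e : rel T) (V : {set T}) : rel T :=
  fun x y => [&& x \in V, y \in V & e x y].

Definition connected_on (T : finType) (e : rel T) (V : {set T}) : Prop :=
  {in V &, forall x y, connect (induced_rel e V) x y}.

Definition connected_reduced_power_graph
    (gT : finGroupType) (G : {group gT}) : Prop :=
  connected_on (@power_adj gT) G^#.

(* As ['GL_n[F]] consists of matrices of size [n.-1.+1], this is the intended
   group only for [0 < n]. *)
Definition PGL (n : nat) (F : finFieldType) :
    {group coset_of 'Z('GL_n[F])} :=
  ('GL_n[F] / 'Z('GL_n[F]))%G.

(* Main.v *)
(* Two commuting elements of coprime orders are powers of their product, so every element of
   PGL is linked to one of prime order, and commuting elements of distinct prime orders are
   linked to each other.

   Connectedness. All unipotent elements lie in one component: when [p < n] a unipotent [1 + N]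
   commutes with an element of order prime to [p] built from the Jordan blocks of [N] (a scalar
   [<> 1] on one block if [q > 2], an element of order 3 mixing two equal blocks if [q = 2]), and
   any two transvections commute with a common element of that kind. An element [X] of prime
   order [s <> p] whose minimal polynomial has degree less than [n] commutes with a square-zero
   matrix, hence is linked to a unipotent. Otherwise the centralizer of [X] is [F[X]], and we look
   there for an element of order prime to [s] and with a smaller minimal polynomial: it comes from
   a proper subfield of a residue field of [F[X]], from a factorization of the minimal polynomial,
   or from a prime [t <> s] dividing the order of a residue field's unit group. All of these fail
   only in the exceptional cases, since [2 ^ e - 1 = s ^ k] forces [k = 1].

   Disconnectedness. Let [X] be the companion matrix of [f] of degree [n], so that its centralizer
   is [F[X]]. If all units of [F[X]] have order dividing a fixed prime in PGL, the group generated
   by [X] is isolated; this happens for [f = (T - 1) ^ n] with [n <= p], and for [f] dividing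
   [T ^ (Q - 1) - 1] with [Q] a power of [q] and [Q - 1] prime. If [f] is irreducible of prime
   degree (or [T - 1] times such a polynomial, for [q = 2]), all nonscalar units of [F[X]] have the
   same centralizer, and [F[X]] is isolated. *)
Require Import Defs.
From mathcomp Require Import all_boot all_order all_algebra all_fingroup.
From mathcomp Require Import all_solvable all_field.
From mathcomp Require Import zify ring.

Set Implicit Arguments.
Unset Strict Implicit.
Unset Printing Implicit Defensive.

Import GRing.Theory.
Local Open Scope ring_scope.

(** * Matrix representatives of the power graph of PGL *)

Section Bridge.

Variables (F : finFieldType) (n : nat).
Implicit Types (A B X : 'M[F]_n.+1) (a : F).

(* Matrix representatives of the nonidentity elements of [PGL]. *)
Definition nsunit A := (A \in unitmx) && ~~ is_scalar_mx A.

(** Singular matrices get the default value 1. *)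
Definition to_GL A : {'GL_n.+1[F]} := insubd (1%g : {'GL_n.+1[F]}) A.

Definition to_PGL A : coset_of 'Z('GL_n.+1[F]) := coset 'Z('GL_n.+1[F]) (to_GL A).

Lemma val_to_GL A : A \in unitmx -> GLval (to_GL A) = A.
Proof. by move=> uA; rewrite /to_GL; apply: (insubdK (1%g : {'GL_n.+1[F]})). Qed.

Lemma GLval_unitmx (x : {'GL_n.+1[F]}) : GLval x \in unitmx.
Proof. exact: (valP x). Qed.

Lemma GLval_inj : injective (@GLval n.+1 F).
Proof. exact: val_inj. Qed.

Lemma to_GLK (x : {'GL_n.+1[F]}) : to_GL (GLval x) = x.
Proof. by apply: GLval_inj; rewrite val_to_GL // GLval_unitmx. Qed.

Lemma unitmx_exp A k : A \in unitmx -> A ^+ k \in unitmx.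
Proof. exact: unitrX. Qed.

Lemma unitmx_mulr A B : A \in unitmx -> B \in unitmx -> A * B \in unitmx.
Proof. by move=> uA uB; rewrite -mulmxE unitmx_mul uA. Qed.

Lemma to_GLM A B : A \in unitmx -> B \in unitmx -> to_GL (A * B) = (to_GL A * to_GL B)%g.
Proof.
move=> uA uB; apply: GLval_inj; rewrite val_to_GL ?unitmx_mulr //.
by rewrite GL_ME !val_to_GL.
Qed.

(** For [i != j], [1 + delta_mx i j] is a unit with inverse [1 - delta_mx i j], so a matrix
    commuting with all units commutes with the off-diagonal matrix units; comparing entries makes it
    scalar. *)
Lemma scalar_cent_unitmx A :
  reflect (forall B, B \in unitmx -> A * B = B * A) (is_scalar_mx A).
Proof.
apply: (iffP is_scalar_mxP) => [[a ->] B _|cA]; first by rewrite -!mulmxE scalar_mxC.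
have cE (i j : 'I_n.+1) : i != j -> A * delta_mx i j = delta_mx i j * A.
  move=> nij; have := cA (1 + delta_mx i j); rewrite mulrDr mulrDl mulr1 mul1r.
  move=> H; apply: (addrI A); apply: H.
  apply/unitrP; exists (1 - delta_mx i j).
  have d2: delta_mx i j * delta_mx i j = 0 :> 'M[F]_n.+1.
    by rewrite -mulmxE mul_delta_mx_cond eq_sym (negbTE nij).
  by rewrite !(mulrDl, mulrDr, mulrN, mulNr, mulr1, mul1r) d2 oppr0 !addr0 subrK addrK.
have eR i j k l : (A * delta_mx i j) k l = A k i *+ (l == j).
  rewrite mxE (bigD1 i) //= big1 => [|x nx]; first by rewrite mxE eqxx addr0 mulr_natr.
  by rewrite mxE (negbTE nx) mulr0.
have eL i j k l : (delta_mx i j * A) k l = A j l *+ (k == i).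
  rewrite mxE (bigD1 j) //= big1 => [|x nx]; first by rewrite mxE eqxx andbT addr0 mulr_natl.
  by rewrite mxE (negbTE nx) andbF mul0r.
exists (A 0 0); apply/matrixP=> i j; rewrite !mxE; have [->|nij] := eqVneq i j.
  rewrite mulr1n; have [->//|n0j] := eqVneq j 0.
  by have /matrixP/(_ j 0) := cE _ _ n0j; rewrite eR eL !eqxx.
have /matrixP/(_ i i) : A * delta_mx j i = delta_mx j i * A by apply: cE; rewrite eq_sym.
by rewrite eR eL eqxx (negbTE nij).
Qed.

Lemma to_GL_center A : A \in unitmx -> (to_GL A \in 'Z('GL_n.+1[F])%g) = is_scalar_mx A.
Proof.
move=> uA; apply/idP/scalar_cent_unitmx => [/centerP[_ cA] B uB | cA].
  have := cA (to_GL B) (in_setT _) => /(congr1 (@GLval _ _)).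
  by rewrite !GL_ME !val_to_GL.
apply/centerP; split=> [|y _]; first exact: in_setT.
apply: GLval_inj; rewrite !GL_ME val_to_GL //.
by apply: cA; rewrite GLval_unitmx.
Qed.

Lemma GL_normZ (x : {'GL_n.+1[F]}) : x \in 'N('Z('GL_n.+1[F]))%g.
Proof.
exact: (subsetP (normal_norm (center_normal 'GL_n.+1[F]))) (in_setT x).
Qed.

Lemma to_PGL_eq1 A : A \in unitmx -> (to_PGL A == 1%g) = is_scalar_mx A.
Proof.
move=> uA; rewrite -to_GL_center //.
by apply/eqP/idP => [/coset_idr -> //|/coset_id //]; apply: GL_normZ.
Qed.

Lemma to_PGLM A B : A \in unitmx -> B \in unitmx -> to_PGL (A * B) = (to_PGL A * to_PGL B)%g.
Proof. by move=> uA uB; rewrite /to_PGL to_GLM //; apply: coset_morphM; apply: GL_normZ. Qed.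

Lemma to_PGLX A k : A \in unitmx -> to_PGL (A ^+ k) = (to_PGL A ^+ k)%g.
Proof.
move=> uA; elim: k => [|k IHk].
  by apply/eqP; rewrite to_PGL_eq1 ?unitmx1 // scalar_mx_is_scalar.
by rewrite exprS expgS to_PGLM ?unitmx_exp // IHk.
Qed.

Lemma to_PGL_in A : to_PGL A \in PGL n.+1 F.
Proof. by apply: mem_quotient; apply: in_setT. Qed.

Lemma to_PGL_inD1 A : A \in unitmx -> (to_PGL A \in (PGL n.+1 F)^#%g) = ~~ is_scalar_mx A.
Proof. by move=> uA; rewrite !inE to_PGL_in andbT to_PGL_eq1. Qed.

Lemma PGL_onto x : x \in (PGL n.+1 F)^#%g -> exists2 A, nsunit A & x = to_PGL A.
Proof.
move=> Gx; have := Gx; case/setD1P=> _ /morphimP[y _ _ defx].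
have defx' : x = to_PGL (GLval y) by rewrite /to_PGL to_GLK.
exists (GLval y) => //; rewrite /nsunit GLval_unitmx /= -to_PGL_inD1 ?GLval_unitmx //.
by rewrite -defx'.
Qed.

Lemma to_PGL_eq A B : A \in unitmx -> B \in unitmx ->
  reflect (exists2 a, a != 0 & B = a *: A) (to_PGL A == to_PGL B).
Proof.
move=> uA uB.
have uV: A^-1 \in unitmx by rewrite unitmx_inv.
have eqV : (to_PGL A == to_PGL B) = is_scalar_mx (A^-1 * B).
  rewrite -to_PGL_eq1 ?unitmx_mulr // to_PGLM //.
  have VA : (to_PGL A^-1 = (to_PGL A)^-1)%g.
    apply: (mulIg (to_PGL A)); rewrite mulVg -to_PGLM // mulVr //.
    by apply/eqP; rewrite to_PGL_eq1 ?unitmx1 // scalar_mx_is_scalar.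
  by rewrite VA eq_sym -(inj_eq (mulgI (to_PGL A)^-1%g)) mulVg.
rewrite eqV; apply: (iffP is_scalar_mxP) => [[a defa]|[a _ ->]]; exists a.
- apply: contraTneq uB => a0; have /(congr1 (fun C => A * C)) := defa.
  by rewrite mulVKr // a0 raddf0 mulr0 => ->; rewrite unitr0.
- by rewrite -mul_mx_scalar mulmxE -defa mulVKr.
- by rewrite -scalerAr mulVr // -scalemx1.
Qed.

(** The two [nsunit] conditions rule out the reflexive pairs that [connect] has outside the vertex
    set. *)
Definition linked A B :=
  [/\ nsunit A, nsunit B
    & connect (induced_rel (@power_adj _) (PGL n.+1 F)^#%g) (to_PGL A) (to_PGL B)].

Lemma power_adj_sym (gT : finGroupType) : symmetric (@power_adj gT).
Proof. by move=> x y; rewrite /power_adj eq_sym orbC. Qed.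

Lemma linked_sym A B : linked A B -> linked B A.
Proof.
case=> pA pB cAB; split=> //; rewrite (sym_connect_sym _) // => x y.
by rewrite /induced_rel power_adj_sym andbA andbA (andbC (x \in _)).
Qed.

Lemma linked_trans B A C : linked A B -> linked B C -> linked A C.
Proof. by case=> pA pB cAB [_ pC cBC]; split=> //; apply: connect_trans cBC. Qed.

Lemma scalar_mx_inj : injective (@scalar_mx F n.+1).
Proof. by move=> a b /matrixP/(_ 0 0); rewrite !mxE !eqxx. Qed.

Lemma linked_exp A k : A \in unitmx -> ~~ is_scalar_mx (A ^+ k) -> linked A (A ^+ k).
Proof.
move=> uA nsAk; have nsA : ~~ is_scalar_mx A.
  apply: contra nsAk => /is_scalar_mxP[a ->].
  by rewrite -(rmorphXn (@scalar_mx F n.+1)) scalar_mx_is_scalar.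
split; rewrite /nsunit ?uA ?unitmx_exp //.
have [->|neq] := eqVneq (to_PGL A) (to_PGL (A ^+ k)); first exact: connect0.
apply: connect1; rewrite /induced_rel !to_PGL_inD1 ?unitmx_exp // nsA nsAk /=.
by rewrite /power_adj neq /= to_PGLX // mem_cycle orbT.
Qed.

(** By the Chinese remainder theorem, each of two commuting elements of coprime orders is, in PGL, a
    power of their product. *)
Lemma linked_coprime A B k l : nsunit A -> nsunit B -> A * B = B * A ->
  is_scalar_mx (A ^+ k) -> is_scalar_mx (B ^+ l) -> coprime k l -> linked A B.
Proof.
move=> /andP[uA nsA] /andP[uB nsB] cAB sAk sBl cokl.
suff half C D i j : C \in unitmx -> D \in unitmx -> ~~ is_scalar_mx C -> C * D = D * C ->
  is_scalar_mx (C ^+ i) -> is_scalar_mx (D ^+ j) -> coprime i j -> linked C (C * D).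
  apply: (@linked_trans (A * B)); first exact: (half A B k l).
  by apply: linked_sym; rewrite cAB; apply: (half B A l k); rewrite // coprime_sym.
move=> uC uD nsC cCD sCi sDj coij; apply: linked_sym.
have uCD := unitmx_mulr uC uD.
have sX (E : 'M[F]_n.+1) (e f : nat) : E \in unitmx -> is_scalar_mx (E ^+ e) -> (e %| f)%N -> is_scalar_mx (E ^+ f).
  move=> uE /is_scalar_mxP[a Ea] /dvdnP[m ->].
  by rewrite mulnC exprM Ea -(rmorphXn (@scalar_mx F n.+1)) scalar_mx_is_scalar.
(* The exponents may be 0: [i = 0] forces [j = 1], so [D] is scalar and [C * D] is the same vertex
   as [C]. *)
have [i0 | i_gt0] := posnP i.
  have j1 : j = 1%N by apply/eqP; rewrite i0 /coprime gcd0n in coij.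
  have /is_scalar_mxP[d Dd] : is_scalar_mx D by rewrite -(expr1 D) -j1.
  have d0: d != 0.
    by apply: contraTneq uD => d0; rewrite Dd d0 raddf0 unitr0.
  have eq: to_PGL C = to_PGL (C * D).
    apply/eqP/to_PGL_eq => //; exists d => //.
    by rewrite Dd -mulmxE mul_mx_scalar.
  split; rewrite -?eq ?connect0 // /nsunit ?uC ?uCD // -to_PGL_inD1 // -eq to_PGL_inD1 //.
(* With [m = 1] modulo [i] and [m = 0] modulo [j], the [m]-th power of [C * D] is [C] in PGL. *)
pose m := chinese i j 1 0.
have mi : m = 1 %[mod i] by apply: chinese_modl.
have mj : m = 0 %[mod j] by apply: chinese_modr.
have eqm : to_PGL ((C * D) ^+ m) = to_PGL C.
  rewrite (exprMn_comm _ cCD) to_PGLM ?unitmx_exp //.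
  have -> : to_PGL (D ^+ m) = 1%g.
    apply/eqP; rewrite to_PGL_eq1 ?unitmx_exp //; apply: sX sDj _ => //.
    by apply/eqP; rewrite mj mod0n.
  rewrite mulg1 to_PGLX //; have Ci1 : (to_PGL C ^+ i = 1)%g.
    by apply/eqP; rewrite -to_PGLX // to_PGL_eq1 ?unitmx_exp.
  by rewrite -(expg_mod m Ci1) mi expg_mod // expg1.
have nsCDm : ~~ is_scalar_mx ((C * D) ^+ m).
  by rewrite -to_PGL_inD1 ?unitmx_exp // eqm to_PGL_inD1.
have [pCD _ con] := linked_exp uCD nsCDm.
by split; rewrite // ?eqm -?eqm // /nsunit ?uC.
Qed.

Lemma linked_prime A : nsunit A -> exists B s,
  [/\ prime s, is_scalar_mx (B ^+ s) & linked A B].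
Proof.
case/andP=> uA nsA; have nt : to_PGL A != 1%g by rewrite to_PGL_eq1.
pose m := #[to_PGL A]%g; have m_gt1 : (1 < m)%N by rewrite order_gt1.
pose s := pdiv m; have s_pr : prime s by apply: pdiv_prime.
have sm : (s %| m)%N := pdiv_dvd m.
exists (A ^+ (m %/ s)%N), s; split=> //.
  rewrite -exprM divnK // -to_PGL_eq1 ?unitmx_exp // to_PGLX //.
  by apply/eqP; apply: expg_order.
apply: linked_exp => //; rewrite -to_PGL_eq1 ?unitmx_exp // to_PGLX //.
have m_gt0 := ltnW m_gt1.
have lt_m : (m %/ s < m)%N by rewrite ltn_Pdiv ?prime_gt1.
have gt0 : (0 < m %/ s)%N by rewrite divn_gt0 ?prime_gt0 // dvdn_leq.
by rewrite -order_dvdn; apply/negP=> /(dvdn_leq gt0); rewrite leqNgt lt_m.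
Qed.

Lemma connected_of_linked A0 : (forall A, nsunit A -> linked A A0) ->
  connected_reduced_power_graph (PGL n.+1 F).
Proof.
move=> lk x y /PGL_onto[A pA ->] /PGL_onto[B pB ->].
by case: (linked_trans (lk A pA) (linked_sym (lk B pB))).
Qed.

Lemma nsunit_noncomm A : nsunit A -> exists2 B, nsunit B & A * B <> B * A.
Proof.
case/andP=> uA /scalar_cent_unitmx nsA.
have [/existsP[B /andP[uB cB]]|] := boolP [exists B, (B \in unitmx) && (A * B != B * A)].
  exists B; last exact/eqP.
  rewrite /nsunit uB /=; apply: contra cB => /scalar_cent_unitmx/(_ A uA) e.
  by apply/eqP; rewrite e.
rewrite negb_exists => /forallP cA; case: nsA => B uB.
by have := cA B; rewrite uB /= negbK => /eqP.
Qed.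

(** A property that ignores scalar factors and is shared by a vertex and its nonscalar powers cuts
    out a union of components; here it contains [A] and misses [B]. *)
Lemma disconnected_of_closed (S : pred 'M[F]_n.+1) A B :
  nsunit A -> S A -> nsunit B -> ~~ S B ->
  (forall a C, a != 0 -> S C -> S (a *: C)) ->
  (forall C k, nsunit C -> nsunit (C ^+ k) -> S C = S (C ^+ k)) ->
  ~ connected_reduced_power_graph (PGL n.+1 F).
Proof.
move=> pA SA pB SB Sscale Spow con.
pose D := [pred x | [exists C, [&& nsunit C, S C & x == to_PGL C]]].
have Scong C E : nsunit C -> nsunit E -> to_PGL C = to_PGL E -> S C -> S E.
  move=> /andP[uC _] /andP[uE _] eqCE SC.
  by have /eqP/(to_PGL_eq uC uE)[a a0 ->] := eqCE; apply: Sscale.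
have inD C : nsunit C -> (to_PGL C \in D) = S C.
  move=> pC; apply/existsP/idP => [[E /and3P[pE SE /eqP eqCE]]|SC].
    by apply: (Scong E C).
  by exists C; rewrite pC SC eqxx.
have clD : closed (induced_rel (@power_adj _) (PGL n.+1 F)^#%g) D.
  apply: intro_closed => [|x y].
    move=> x y; rewrite (sym_connect_sym _) // => {}x {}y.
    by rewrite /induced_rel power_adj_sym andbA andbA (andbC (x \in _)).
  case/and3P=> /PGL_onto[C pC ->] /PGL_onto[E pE ->] adj.
  rewrite !inD // => SC; have [uC _] := andP pC; have [uE _] := andP pE.
  have pw C1 C2 : nsunit C1 -> nsunit C2 -> to_PGL C1 \in <[to_PGL C2]>%g -> S C1 = S C2.
    move=> pC1 pC2 /cycleP[k]; have [u2 _] := andP pC2; rewrite -to_PGLX // => eqk.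
    have pk: nsunit (C2 ^+ k).
      have [u1 ns1] := andP pC1; rewrite /nsunit unitmx_exp //= -to_PGL_inD1 ?unitmx_exp //.
      by rewrite -eqk to_PGL_inD1.
    by rewrite (Spow C2 k) //; apply/idP/idP; apply: Scong.
  by case/andP: adj => _ /orP[/(pw _ _ pC pE) <-|/(pw _ _ pE pC) ->].
have [uA nsA] := andP pA; have [uB nsB] := andP pB.
have := con (to_PGL A) (to_PGL B); rewrite !to_PGL_inD1 // => /(_ nsA nsB).
by move/(closed_connect clD); rewrite !inD // SA (negbTE SB).
Qed.

End Bridge.

(** * Unipotent elements *)

Section Hub.

Variables (F : finFieldType) (n p : nat).
Hypothesis charFp : p \in [pchar F].
Implicit Types (A B X N : 'M[F]_n.+1) (a : F).

Let p_prime : prime p := pcharf_prime charFp.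

Lemma pchar_mx : p \in [pchar 'M[F]_n.+1].
Proof.
rewrite inE p_prime /=; apply/eqP.
by rewrite -(rmorph_nat (@scalar_mx F n.+1)) (pcharf0 charFp) rmorph0.
Qed.

Lemma unip_expp N : N * N = 0 -> (1 + N) ^+ p = 1.
Proof.
move=> N2; have := pFrobenius_autD_comm pchar_mx (commr_sym (commr1 N)).
rewrite !pFrobenius_autE => ->; rewrite expr1n.
case: p (prime_gt1 p_prime) => [|[|r]] // _.
by rewrite !exprS mulrA N2 mul0r addr0.
Qed.

Lemma unit_of_exp A m : (0 < m)%N -> A ^+ m = 1 -> A \in unitmx.
Proof. by case: m => // m _ Am; apply/unitrP; exists (A ^+ m); rewrite -exprS -exprSr. Qed.

Lemma nsunit_unip N : N != 0 -> N * N = 0 -> nsunit (1 + N).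
Proof.
move=> N0 N2; apply/andP; split.
  by apply: (unit_of_exp (prime_gt0 p_prime)); apply: unip_expp.
apply: contra N0 => /is_scalar_mxP[a defN].
have defN' : N = (a - 1)%:M by rewrite raddfB /= -defN addrC addKr.
move: N2; rewrite defN' -rmorphM -(raddf0 (@scalar_mx F n.+1)) => /scalar_mx_inj/eqP.
by rewrite mulf_eq0 orbb => /eqP ->.
Qed.

Lemma rank1_gt0 (v : 'rV[F]_n.+1) (f : 'cV[F]_n.+1) :
  v != 0 -> f != 0 -> f *m v != 0.
Proof.
move=> v0 f0; rewrite -mxrank_eq0 mxrankMfree ?mxrank_eq0 //.
by rewrite /row_free rank_rV v0.
Qed.

(** Such an [E] may send 1 to a proper idempotent; completing [E G] by the complementary idempotent
    gives [1 + E (G - 1)]. *)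
Lemma mulr1D_hom k (E : 'M[F]_k.+1 -> 'M[F]_n.+1) :
  {morph E : G H / G * H} -> {morph E : G H / G + H} ->
  {morph (fun G => 1 + E (G - 1)) : G H / G * H}.
Proof.
move=> EM ED G H /=; rewrite mulrDl mul1r mulrDr mulr1 -addrA -EM -!ED.
congr (1 + E _); rewrite mulrBl mul1r (mulrBr G) mulr1 [RHS]addrC -addrA subrK.
by rewrite addrC subrKA.
Qed.

Lemma expr1D_hom k (E : 'M[F]_k.+1 -> 'M[F]_n.+1) :
  {morph E : G H / G * H} -> {morph E : G H / G + H} ->
  forall G j, (1 + E (G - 1)) ^+ j = 1 + E (G ^+ j - 1).
Proof.
move=> EM ED G; elim=> [|j IHj].
  suff -> : E (1 - 1) = 0 by rewrite addr0.
  by apply: (addrI (E 0)); rewrite subrr -ED !addr0.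
by rewrite !exprS IHj (mulr1D_hom EM ED).
Qed.

(** * Elements of order prime to the characteristic, embedded from a small matrix [g] *)

Section Embedding.

Variables (k m : nat) (g : 'M[F]_k.+1).
Hypotheses (g_neq1 : g != 1) (expg : g ^+ m = 1) (co_mp : coprime m p).

Let m_gt0 : (0 < m)%N.
Proof.
case: m co_mp => //; rewrite /coprime gcd0n => /eqP p1.
by have := p_prime; rewrite p1.
Qed.

Lemma linked_commute X A : nsunit X -> is_scalar_mx (X ^+ p) ->
  A ^+ m = 1 -> ~~ is_scalar_mx A -> X * A = A * X -> linked X A.
Proof.
move=> nsX sX Am nsA cXA; apply: (linked_coprime nsX _ cXA sX (l := m)).
- by rewrite /nsunit nsA (unit_of_exp m_gt0 Am).
- by rewrite Am scalar_mx_is_scalar.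
- by rewrite coprime_sym.
Qed.

(** The matrix [1 + W *m (g - 1) *m U] acts as [g] on the rows of [U] and trivially on the vectors
    killed by [W]. Its product with [N] on either side is [N], so it commutes with [1 + N], and its
    [m]-th power is 1. *)
Lemma nilp_linked (U : 'M[F]_(k.+1, n.+1)) (W : 'M[F]_(n.+1, k.+1)) N :
  U *m W = 1%:M -> N != 0 -> N * N = 0 -> N *m W = 0 -> U *m N = 0 ->
  linked (1 + N) (1 + W *m (g - 1) *m U).
Proof.
move=> UW N0 N2 NW UN.
pose h (G : 'M[F]_k.+1) : 'M[F]_n.+1 := 1 + W *m (G - 1) *m U.
have hX j : h g ^+ j = h (g ^+ j).
  apply: (expr1D_hom (E := fun G => W *m G *m U)) => G H; last by rewrite mulmxDr mulmxDl.
  rewrite -[RHS]/(_ *m _) !mulmxA; by rewrite -(mulmxA _ U W) UW mulmx1.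
have hN : N * h g = N by rewrite /h mulrDr mulr1 -mulmxE !mulmxA NW !mul0mx addr0.
have Nh : h g * N = N by rewrite /h mulrDl mul1r -mulmxE -!mulmxA UN !mulmx0 addr0.
rewrite -/(h g); apply: linked_commute.
- exact: nsunit_unip.
- by rewrite unip_expp // scalar_mx_is_scalar.
- by rewrite hX expg /h subrr mulmx0 mul0mx addr0.
(* A scalar value [a] would be 1 because it fixes [N], and the action on [U] would then give
   [g = 1]. *)
- apply: contra g_neq1 => /is_scalar_mxP[a ha].
  have a1 : a = 1.
    apply/eqP; rewrite -subr_eq0; apply: contraTT N0 => a1; rewrite negbK.
    have : (a - 1) *: N = 0.
      rewrite scalerBl scale1r; apply/eqP; rewrite subr_eq0 -mul_mx_scalar -ha.
      by rewrite mulmxE hN.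
    by move/eqP; rewrite scaler_eq0 (negbTE a1).
  have : U *m h g = g *m U.
    rewrite /h mulmxDr (mulmx1 U : U *m 1 = U) !mulmxA UW mul1mx mulmxBl.
    by rewrite (mul1mx U : 1 *m U = U) addrC subrK.
  rewrite ha a1 mulmx1 => /(congr1 (mulmxr W)) /=.
  by rewrite -mulmxA UW mulmx1 => <-.
- by rewrite mulrDl mul1r (mulrDr (h g)) mulr1 hN Nh.
Qed.

(** The rows of [U] are taken in the kernel of [D], in a complement to the rows of [C]; the rank
    bound leaves at least [k.+1] of them. [W] comes from the projection onto [U] along [C]. *)
Lemma ex_complement c d (C : 'M[F]_(c, n.+1)) (D : 'M[F]_(n.+1, d)) :
  (\rank C + \rank D + k.+1 <= n.+1)%N ->
  exists U : 'M[F]_(k.+1, n.+1), exists W : 'M[F]_(n.+1, k.+1),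
    [/\ U *m W = 1%:M, U *m D = 0 & C *m W = 0].
Proof.
move=> rkCD; pose K := kermx D; pose R := (K :\: C)%MS.
have rkR : (k.+1 <= \rank R)%N.
  have := mxrank_cap_compl K C; rewrite -/R mxrank_ker => eqR.
  have : (\rank (K :&: C)%MS <= \rank C)%N by apply: mxrankS (capmxSr _ _).
  move: (\rank _) (\rank R) (\rank C) (\rank D) rkCD eqR => x y z t; lia.
pose U : 'M[F]_(k.+1, n.+1) := pid_mx k.+1 *m row_base R.
have frU : row_free U.
  by rewrite /row_free mxrankMfree ?row_base_free // rank_pid_mx.
have sUR : (U <= R)%MS by apply: submx_trans (submxMl _ _) _; rewrite eq_row_base.
have UC0 : (<<U>> :&: <<C>> = 0)%MS.
  apply/eqP; rewrite -submx0 -(capmx_diff K C); apply: capmxS.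
    by rewrite genmxE.
  by rewrite genmxE.
exists U, (proj_mx <<U>>%MS <<C>>%MS *m pinvmx U); split.
- by rewrite mulmxA proj_mx_id ?genmxE // mulmxVp.
- apply/eqP; rewrite -sub_kermx; apply: submx_trans sUR _; exact: diffmxSl.
- by rewrite mulmxA proj_mx_0 ?genmxE // mul0mx.
Qed.

(** A single pair [U], [W] annihilated by both [N1] and [N2] yields one element commuting with both
    unipotents. *)
Lemma linked_nilp N1 N2 : N1 != 0 -> N2 != 0 -> N1 * N1 = 0 -> N2 * N2 = 0 ->
  (\rank (col_mx N1 N2) + \rank (row_mx N1 N2) + k.+1 <= n.+1)%N ->
  linked (1 + N1) (1 + N2).
Proof.
move=> N10 N20 sq1 sq2 /ex_complement[U [W [UW]]].
rewrite mul_mx_row mul_col_mx -col_mx0 -row_mx0.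
case/eq_row_mx=> U1 U2 /eq_col_mx[W1 W2].
by apply: linked_trans (nilp_linked UW N10 sq1 W1 U1) (linked_sym (nilp_linked UW N20 sq2 W2 U2)).
Qed.

Lemma linked_transvections (v w : 'rV[F]_n.+1) (f h : 'cV[F]_n.+1) :
  (k + 3 <= n)%N -> v != 0 -> w != 0 -> f != 0 -> h != 0 ->
  v *m f = 0 -> w *m h = 0 -> linked (1 + f *m v) (1 + h *m w).
Proof.
move=> n3 v0 w0 f0 h0 vf wh.
have sq0 (x : 'rV[F]_n.+1) (y : 'cV_n.+1) : x *m y = 0 -> (y *m x) * (y *m x) = 0.
  by move=> xy; rewrite -mulmxE mulmxA -(mulmxA y) xy mulmx0 mul0mx.
have rk1 r s (x : 'M[F]_(r, 1)) (y : 'M_(1, s)) : (\rank (x *m y) <= 1)%N.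
  by apply: leq_trans (mxrankM_maxr _ _) (rank_leq_row _).
have rk3 (a b : nat) : (a + b <= 3)%N -> (a + b + k.+1 <= n.+1)%N by lia.
(* Changing [v] and [f] one at a time leaves room for [U] and [W] already in dimension 4. *)
have swap_f (x : 'rV[F]_n.+1) y z : x != 0 -> y != 0 -> z != 0 ->
  x *m y = 0 -> x *m z = 0 -> linked (1 + y *m x) (1 + z *m x).
  move=> x0 y0 z0 xy xz; apply: linked_nilp; rewrite ?rank1_gt0 ?sq0 //.
  rewrite -mul_col_mx; apply: rk3; apply: (leq_add (rk1 _ _ _ _)).
  rewrite -mxrank_tr tr_row_mx -addsmxE; apply: leq_trans (mxrank_adds_leqif _ _) _.
  by rewrite !mxrank_tr (leq_add (rk1 _ _ _ _) (rk1 _ _ _ _)).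
have swap_v (x y : 'rV[F]_n.+1) z : x != 0 -> y != 0 -> z != 0 ->
  x *m z = 0 -> y *m z = 0 -> linked (1 + z *m x) (1 + z *m y).
  move=> x0 y0 z0 xz yz; apply: linked_nilp; rewrite ?rank1_gt0 ?sq0 //.
  rewrite -mul_mx_row; apply: rk3; apply: (@leq_add _ _ 2 1 _ (rk1 _ _ _ _)).
  rewrite -addsmxE; apply: leq_trans (mxrank_adds_leqif _ _) _.
  exact: (leq_add (rk1 _ _ _ _) (rk1 _ _ _ _)).
(* A column killed by both [v] and [w] is the meeting point: the path goes from [(f, v)] to
   [(f', v)], [(f', w)] and [(h, w)]. *)
have [f' f'0 [vf' wf']] : exists2 f' : 'cV[F]_n.+1, f' != 0 & v *m f' = 0 /\ w *m f' = 0.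
  pose M := col_mx v w; have rkM : (\rank M <= 2)%N by apply: rank_leq_row.
  have : cokermx M != 0.
    by rewrite -mxrank_eq0 mxrank_coker; lia.
  case/matrix0Pn=> i [j cij]; exists (col j (cokermx M)).
    by apply/matrix0Pn; exists i, 0; rewrite mxE.
  have /eqP := mulmx_coker M; rewrite mul_col_mx col_mx_eq0 => /andP[/eqP ve /eqP we].
  by split; rewrite colE mulmxA ?ve ?we mul0mx.
apply: linked_trans (swap_f _ _ _ v0 f0 f'0 vf vf') _.
apply: linked_trans (swap_v _ _ _ v0 w0 f'0 vf' wf') _.
exact: swap_f.
Qed.

Lemma linked_small_rank N1 N2 : N1 != 0 -> N2 != 0 -> N1 * N1 = 0 -> N2 * N2 = 0 ->
  (2 * (\rank N1 + \rank N2) + k.+1 <= n.+1)%N -> linked (1 + N1) (1 + N2).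
Proof.
move=> N10 N20 sq1 sq2 rk; apply: linked_nilp => //; apply: leq_trans rk.
rewrite leq_add2r mul2n -addnn leq_add //.
  by rewrite -addsmxE (mxrank_adds_leqif _ _).
by rewrite -mxrank_tr tr_row_mx -addsmxE -(mxrank_tr N1) -(mxrank_tr N2) (mxrank_adds_leqif _ _).
Qed.

(* [N] acts on the span of the [V N^i] as [k.+1] Jordan blocks of size [d.+1], and [E]
   identifies the matrices of size [k.+1] with operators that commute with [N] there. *)
Lemma linked_jordan a N d (V : 'M[F]_(k.+1, n.+1)) (W : 'M[F]_(n.+1, k.+1)) :
  nsunit (a%:M + N) -> is_scalar_mx ((a%:M + N) ^+ p) ->
  (0 < d)%N -> (k.+1 * d.+1 < n.+1)%N -> N ^+ d.+1 = 0 ->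
  (forall j, V *m N ^+ j *m W = (j == d)%:R%:M) ->
  let N' := N ^+ d *m W *m (V *m N ^+ d) in
  [/\ N' != 0, N' * N' = 0, (\rank N' <= k.+1)%N & linked (a%:M + N) (1 + N')].
Proof.
move=> nsX sX d_gt0 dn Nd VW N'.
have Nbig j : (d < j)%N -> N ^+ j = 0.
  by move=> dj; rewrite -(subnK dj) exprD Nd mulr0.
pose E (G : 'M[F]_k.+1) : 'M[F]_n.+1 :=
  \sum_(i < d.+1) N ^+ (d - i) *m W *m G *m (V *m N ^+ i).
have VNW (i j : 'I_d.+1) : (V *m N ^+ i) *m (N ^+ (d - j) *m W) = (i == j)%:R%:M.
  rewrite mulmxA -(mulmxA V) mulmxE -exprD VW; congr (_ %:R%:M).
  by congr nat_of_bool; apply/eqP/eqP => [e|->]; [apply: val_inj => /=|]; have := ltn_ord j; lia.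
have EM G H : E (G * H) = E G * E H.
  rewrite /E mulr_suml; apply: eq_bigr => i _; rewrite mulr_sumr.
  have tE j : (N ^+ (d - i) *m W *m G *m (V *m N ^+ i)) * (N ^+ (d - j) *m W *m H *m (V *m N ^+ j))
      = (N ^+ (d - i) *m W *m G) *m ((V *m N ^+ i) *m (N ^+ (d - j) *m W)) *m (H *m (V *m N ^+ j)).
    by rewrite -[LHS]/(_ *m _) !mulmxA.
  rewrite (bigD1 i) //= big1 => [|j nji].
    by rewrite addr0 tE VNW eqxx mulmx1 -[G * H]/(G *m H) !mulmxA.
  by rewrite tE VNW eq_sym (negbTE nji) raddf0 mulmx0 mul0mx.
have EN G : E G * N = N * E G.
  have tN (i j : nat) : (N ^+ i *m W *m G *m (V *m N ^+ j)) * N = N ^+ i *m W *m G *m (V *m N ^+ j.+1).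
    by rewrite exprSr -[LHS]/(_ *m _) -[N ^+ j * N]/(_ *m _) !mulmxA.
  have Nt (i j : nat) : N * (N ^+ i *m W *m G *m (V *m N ^+ j)) = N ^+ i.+1 *m W *m G *m (V *m N ^+ j).
    by rewrite exprS -[LHS]/(_ *m _) -[N * N ^+ i]/(_ *m _) !mulmxA.
  (* Multiplication by [N] on the two sides gives the same sum up to a shift of the index; the
     extreme terms vanish because [N ^+ d.+1 = 0]. *)
  rewrite /E mulr_suml mulr_sumr; under eq_bigr do rewrite tN.
  under [RHS]eq_bigr do rewrite Nt.
  rewrite big_ord_recr big_ord_recl /= Nd subn0 Nd !mul0mx !mulmx0 add0r addr0.
  by apply: eq_bigr => i _; rewrite /bump /= add1n -subSn // ltn_ord.
have ED G H : E (G + H) = E G + E H.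
  by rewrite /E -big_split; apply: eq_bigr => i _; rewrite /= mulmxDr mulmxDl.
pose VN := V *m N ^+ d; pose NW := N ^+ d *m W.
have VNNW : VN *m W = 1%:M by rewrite VW eqxx.
have VN_NW : V *m NW = 1%:M by rewrite mulmxA VW eqxx.
have VNE G : VN *m E G = G *m VN.
  rewrite mulmx_sumr big_ord_recr big1 /= => [|i _].
    by rewrite subnn expr0 add0r (mul1mx W : 1 *m W = W) !mulmxA VNNW mul1mx.
  have -> : VN *m (N ^+ (d - i) *m W *m G *m (V *m N ^+ i)) = V *m N ^+ (d + (d - i)) *m W *m (G *m (V *m N ^+ i)).
    by rewrite exprD -[N ^+ d * _]/(_ *m _) !mulmxA.
  rewrite VW; have -> : (d + (d - i) == d)%N = false by have := ltn_ord i; lia.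
  by rewrite raddf0 mul0mx.
have ENW G : E G *m NW = NW *m G.
  rewrite mulmx_suml big_ord_recl big1 /= => [|i _].
    by rewrite expr0 subn0 addr0 (mulmx1 V : V *m 1 = V) -!mulmxA VN_NW mulmx1 mulmxA.
  have -> : N ^+ (d - bump 0 i) *m W *m G *m (V *m N ^+ bump 0 i) *m NW
      = N ^+ (d - bump 0 i) *m W *m G *m (V *m N ^+ (bump 0 i + d) *m W).
    by rewrite exprD -[N ^+ _ * N ^+ d]/(_ *m _) !mulmxA.
  rewrite VW; have -> : (bump 0 i + d == d)%N = false by rewrite /bump; lia.
  by rewrite raddf0 mulmx0.
(* [N'] agrees with [N ^+ d] on the chosen blocks and commutes with every [E G]. *)
have N'E : N' = NW *m VN by rewrite /N' mulmxA.
have EN' G : E G * N' = N' * E G.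
  rewrite N'E -[LHS]/(_ *m _) -[RHS]/(_ *m _) mulmxA ENW.
  by rewrite -[RHS]mulmxA VNE mulmxA.
have N'0 : N' != 0.
  apply/eqP => N'0; have : V *m N' *m W = 1%:M.
    by rewrite N'E mulmxA VN_NW mul1mx.
  by rewrite N'0 mulmx0 mul0mx => /esym/eqP; rewrite oner_eq0.
have N'2 : N' * N' = 0.
  have -> : N' * N' = NW *m (V *m N ^+ (d + d) *m W) *m VN.
    by rewrite exprD -[N ^+ d * _]/(_ *m _) /N' -[LHS]/(_ *m _) !mulmxA.
  by rewrite VW -{3}[d]addn0 eqn_add2l eqn0Ngt d_gt0 raddf0 mulmx0 mul0mx.
have rkN' : (\rank N' <= k.+1)%N.
  by rewrite N'E; apply: leq_trans (mxrankM_maxr _ _) (rank_leq_row _).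
pose h := 1 + E (g - 1).
have E0 : E 0 = 0 by apply: (addrI (E 0)); rewrite -ED !addr0.
have hm : h ^+ m = 1 by rewrite (expr1D_hom EM ED) expg subrr E0 addr0.
have nsh : ~~ is_scalar_mx h.
  apply/is_scalar_mxP => [[b hb]].
  have gb : g = b%:M.
    have : VN *m h = g *m VN.
      rewrite mulmxDr (mulmx1 VN : VN *m 1 = VN) VNE mulmxBl (mul1mx VN : 1 *m VN = VN).
      by rewrite addrC subrK.
    rewrite hb => /(congr1 (mulmxr W)) /=.
    by rewrite mul_mx_scalar -scalemxAl -mulmxA VNNW mulmx1 scalemx1.
  (* If [h] is the scalar [b], then [E (g - 1)] is the scalar [b - 1], of rank at most
     [k.+1 * d.+1 < n.+1]; so [b = 1], against [g != 1]. *)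
  have rkE G : (\rank (E G) <= k.+1 * d.+1)%N.
    rewrite /E; apply: (@leq_trans (\sum_(i < d.+1) k.+1)); last first.
      by rewrite sum_nat_const card_ord mulnC.
    apply: (big_ind2 (fun (M : 'M[F]_n.+1) r => \rank M <= r)%N).
    - by rewrite mxrank0.
    - by move=> A r B s rA sB; apply: leq_trans (mxrank_add _ _) (leq_add rA sB).
    by move=> i _; apply: leq_trans (mxrankM_maxr _ _) (rank_leq_row _).
  have := rkE (g - 1); rewrite leqNgt => /negP[].
  have -> : E (g - 1) = (b - 1)%:M.
    have -> : E (g - 1) = h - 1 by rewrite /h (addrC 1) addrK.
    by rewrite hb raddfB.
  rewrite -scalemx1 mxrank_scale_nz ?mxrank1 ?subr_eq0 //.
  by apply: contra_neq g_neq1 => b1; rewrite gb b1.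
have hN' : N' * h = h * N' by rewrite /h mulrDl mulrDr mul1r mulr1 EN'.
have hN : N * h = h * N by rewrite /h mulrDl mulrDr mul1r mulr1 EN.
split=> //; apply: (@linked_trans _ _ h).
  apply: linked_commute => //.
  have ha : h * a%:M = a%:M * h := scalar_mxC _ _.
  by rewrite (mulrDl _ _ h) (mulrDr h) hN ha.
apply/linked_sym/linked_commute => //; first exact: nsunit_unip.
  by rewrite unip_expp // scalar_mx_is_scalar.
by rewrite (mulrDl _ _ h) (mulrDr h) mul1r mulr1 hN'.
Qed.




End Embedding.

End Hub.

Lemma card2_neq0 (F : finFieldType) (a : F) : #|F| = 2%N -> a != 0 -> a = 1.
Proof.
move=> F2 a0; apply/eqP; apply: contraT => a1.
have us : uniq [:: 0; 1; a] by rewrite /= !inE !(eq_sym _ a) negb_or eq_sym oner_eq0 a0 a1.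
by have := max_card [in [:: 0; 1; a]]; rewrite (card_uniqP us) F2.
Qed.

Section Unipotent.

Variables (F : finFieldType) (n p : nat).
Hypothesis charFp : p \in [pchar F].
Implicit Types (A B X N : 'M[F]_n.+1) (a : F).

Let p_prime : prime p := pcharf_prime charFp.

Lemma card_pnat : p.-nat #|F|.
Proof.
by rewrite -cardsT; apply: abelem_pgroup (fin_ring_pchar_abelem charFp).
Qed.

Lemma dvdn_pchar_card : (p %| #|F|)%N.
Proof.
have [[|e] F1] := p_natP card_pnat; last by rewrite F1 expnS dvdn_mulr.
by have := finNzRing_gt1 F; rewrite F1.
Qed.

Lemma coprime_card_pred j : (0 < j)%N -> coprime (#|F| ^ j).-1 p.
Proof.
move=> j0; rewrite coprime_sym prime_coprime //; apply/negP => pm.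
have : (p %| 1)%N.
  rewrite -(dvdn_addr 1 pm) addn1 prednK; last by rewrite expn_gt0 ltnW ?finNzRing_gt1.
  by rewrite -(prednK j0) expnS dvdn_mulr // dvdn_pchar_card.
by rewrite dvdn1 => /eqP p1; have := p_prime; rewrite p1.
Qed.

(** The rows of [V] start [k] Jordan chains with independent last vectors [V *m N ^+ d], and [W] is
    dual to these and kills the earlier vectors. A right inverse of [V *m N ^+ d] is corrected one
    exponent at a time, downwards from [d]. *)
Lemma jordan_basis k N d : N ^+ d.+1 = 0 -> (k <= \rank (N ^+ d))%N ->
  exists V : 'M[F]_(k, n.+1), exists W : 'M[F]_(n.+1, k),
    forall j, V *m N ^+ j *m W = (j == d)%:R%:M.
Proof.
move=> Nd rkN; have Nbig j : (d < j)%N -> N ^+ j = 0.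
  by move=> dj; rewrite -(subnK dj) exprD Nd mulr0.
pose U : 'M[F]_(k, n.+1) := pid_mx k *m row_base (N ^+ d).
have frU : row_free U by rewrite /row_free mxrankMfree ?row_base_free // rank_pid_mx.
have /submxP[V defU] : (U <= N ^+ d)%MS.
  by apply: submx_trans (submxMl _ _) _; rewrite eq_row_base.
exists V.
suff /(_ d (leqnn d))[W VW] : forall r, (r <= d)%N -> exists W : 'M[F]_(n.+1, k),
    forall j, (d - r <= j)%N -> V *m N ^+ j *m W = (j == d)%:R%:M.
  by exists W => j; apply: VW; rewrite subnn.
elim=> [|r IHr] rd.
  exists (pinvmx U) => j; rewrite subn0 leq_eqVlt => /predU1P[<-|dj].
    by rewrite -defU mulmxVp // eqxx.
  by rewrite Nbig // gtn_eqF // mulmx0 mul0mx raddf0.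
have [W VW] := IHr (ltnW rd).
(* The correction cancels the value at the exponent [d - r.+1]; at larger exponents it involves a
   power of [N] beyond [d], which is 0. *)
exists (W - N ^+ r.+1 *m W *m (V *m N ^+ (d - r.+1) *m W)) => j dj.
have -> : V *m N ^+ j *m (W - N ^+ r.+1 *m W *m (V *m N ^+ (d - r.+1) *m W))
    = V *m N ^+ j *m W - V *m N ^+ (j + r.+1) *m W *m (V *m N ^+ (d - r.+1) *m W).
  by rewrite mulmxBr exprD -[N ^+ j * _]/(_ *m _) !mulmxA.
have [ej|nej] := eqVneq j (d - r.+1)%N.
  rewrite -ej (VW (j + r.+1)%N); last by lia.
  have -> : (j + r.+1)%N = d by lia.
  by rewrite eqxx mul1mx subrr ltn_eqF ?raddf0 //; lia.
rewrite VW; last by lia.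
by rewrite Nbig ?mulmx0 ?mul0mx ?subr0 //; lia.
Qed.

(** Frobenius is bijective on [F], so the scalar [X ^+ p] is [a ^+ p] for some [a], and [X - a] is
    nilpotent of index [d.+1 <= p]. *)
Lemma unip_split X : nsunit X -> is_scalar_mx (X ^+ p) ->
  exists a N d, [/\ X = a%:M + N, N != 0, (0 < d < p)%N, N ^+ d.+1 = 0 & N ^+ d != 0].
Proof.
case/andP=> uX nsX /is_scalar_mxP[c Xc].
have [a ap] : exists a, a ^+ p = c.
  have inj : injective (pFrobenius_aut charFp) by apply: fmorph_inj.
  by exists (invF inj c); rewrite -(pFrobenius_autE charFp) f_invF.
pose N := X - a%:M.
have Np : N ^+ p = 0.
  have := pFrobenius_autB_comm (pchar_mx n charFp) (scalar_mxC a X).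
  rewrite !pFrobenius_autE => ->.
  by rewrite Xc -(rmorphXn (@scalar_mx F n.+1)) ap subrr.
have N0 : N != 0.
  by apply: contra nsX; rewrite subr_eq0 => /eqP ->; apply: scalar_mx_is_scalar.
have exN : exists j, N ^+ j == 0 by exists p; rewrite Np.
case: (ex_minnP exN) => [[|[|d]]] /eqP Nd mind.
- by have := oner_neq0 'M[F]_n.+1; rewrite -Nd eqxx.
- by rewrite -Nd expr1 eqxx in N0.
exists a, N, d.+1; split=> //.
- by rewrite /N addrC subrK.
- by rewrite /= mind // Np.
by apply/negP => /mind; rewrite ltnn.
Qed.

Definition hub (T : 'M[F]_n.+1) := forall X, nsunit X -> is_scalar_mx (X ^+ p) -> linked X T.

(** One Jordan block of size at most [p < n.+1] leaves room for a scalar other than 1 on it, which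
    leads to a transvection; transvections are linked to each other. *)
Lemma hub_of_card_gt2 : (2 < #|F|)%N -> (3 <= n)%N -> (p <= n)%N -> exists T, hub T.
Proof.
move=> F3 n3 pn.
have [a /andP[a0 a1]] : exists a : F, (a != 0) && (a != 1).
  apply/existsP; apply: contraLR F3; rewrite negb_exists -leqNgt => /forallP aF.
  have : (#|F| <= #|[set (0%R : F); 1%R]|)%N.
    apply: subset_leq_card; apply/subsetP => x _; rewrite !inE.
    by have := aF x; rewrite negb_and !negbK.
  by rewrite cards2 eq_sym oner_eq0.
pose g : 'M[F]_1 := a%:M; pose m := #|F|.-1.
have g1 : g != 1.
  by apply: contra a1 => /eqP/matrixP/(_ 0 0); rewrite !mxE !eqxx => /eqP.
have gm : g ^+ m = 1.
  have am : a ^+ m = 1.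
    apply: (mulfI a0); rewrite -exprS prednK ?expf_card ?mulr1 //.
    by apply/card_gt0P; exists a.
  by rewrite -(rmorphXn (@scalar_mx F 1)) am.
have mp : coprime m p by rewrite /m -(expn1 #|F|) coprime_card_pred.
pose e0 : 'rV[F]_n.+1 := delta_mx 0 0; pose f1 : 'cV[F]_n.+1 := delta_mx ord_max 0.
have e00 : e0 != 0 by apply/matrix0Pn; exists 0, 0; rewrite mxE !eqxx oner_eq0.
have f10 : f1 != 0 by apply/matrix0Pn; exists ord_max, 0; rewrite mxE !eqxx oner_eq0.
have ef : e0 *m f1 = 0.
  by rewrite mul_delta_mx_cond -val_eqE /= eq_sym gtn_eqF //; lia.
exists (1 + f1 *m e0) => X nsX Xp.
have [b [N [d [defX N0 /andP[d0 dp] Nd Nd0]]]] := unip_split nsX Xp.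
have [|V [W VW]] := @jordan_basis 1 N d Nd; first by rewrite lt0n mxrank_eq0.
have [|||N'0 sqN' _ lk] := linked_jordan charFp g1 gm mp (a := b) (N := N) _ _ d0 _ Nd VW.
- by rewrite -defX.
- by rewrite -defX.
- by rewrite mul1n ltnS (leq_trans dp).
rewrite defX; apply: linked_trans lk _.
apply: (linked_transvections charFp g1 gm mp) => //.
- by apply: contraNneq N'0 => ->; rewrite mulmx0.
- by apply: contraNneq N'0 => ->; rewrite mul0mx.
have -> : V *m N ^+ d *m (N ^+ d *m W) = V *m N ^+ (d + d) *m W.
  by rewrite exprD -[N ^+ d * _]/(_ *m _) !mulmxA.
by rewrite VW -{3}[d]addn0 eqn_add2l eqn0Ngt d0 raddf0.
Qed.

(** The only unit scalar is 1, so an element of order 3 acting on two equal blocks replaces it. Here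
    [N] has square zero, and an [N] of rank above 2 is first traded for one of rank at most 2. *)
Lemma hub_of_card2 : #|F| = 2%N -> (7 <= n)%N -> exists T, hub T.
Proof.
move=> F2 n7.
have p2 : p = 2%N.
  by have := dvdn_pchar_card; rewrite F2 dvdn_prime2 // => /eqP.
have add11 : 1 + 1 = 0 :> F by have := pcharf0 charFp; rewrite p2.
(* This is the companion matrix of [T^2 + T + 1], of order 3. *)
pose g : 'M[F]_2 := \matrix_(i, j) ((i != 0) || (j != 0))%:R.
have gE : g * g = g + 1.
  by apply/matrixP=> i j; rewrite !mxE big_ord_recl big_ord1 !mxE;
     case: (unliftP ord0 i) => [i'|] ->; case: (unliftP ord0 j) => [j'|] ->;
     rewrite ?(ord1 i') ?(ord1 j') /= ?mulr1 ?mulr0 ?add0r ?addr0.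
have g1 : g != 1.
  by apply/eqP => /matrixP/(_ 0 0)/eqP; rewrite !mxE /= eq_sym oner_eq0.
have g3 : g ^+ 3 = 1.
  rewrite !exprS expr0 mulr1 gE mulrDr gE mulr1 addrAC.
  suff -> : g + g = 0 by rewrite add0r.
  by apply/matrixP=> i j; rewrite !mxE; case: (_ || _); rewrite ?add11 ?addr0.
have cop : coprime 3 p by rewrite p2.
pose e0 : 'rV[F]_n.+1 := delta_mx 0 0; pose f1 : 'cV[F]_n.+1 := delta_mx ord_max 0.
have e00 : e0 != 0 by apply/matrix0Pn; exists 0, 0; rewrite mxE !eqxx oner_eq0.
have f10 : f1 != 0 by apply/matrix0Pn; exists ord_max, 0; rewrite mxE !eqxx oner_eq0.
have ef : e0 *m f1 = 0.
  by rewrite mul_delta_mx_cond -val_eqE /= eq_sym gtn_eqF //; lia.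
pose T := f1 *m e0; have T0 : T != 0 by apply: rank1_gt0.
have T2 : T * T = 0 by rewrite -[T * T]/(_ *m _) mulmxA -(mulmxA f1) ef mulmx0 mul0mx.
have rkT : (\rank T <= 1)%N by apply: leq_trans (mxrankM_maxr _ _) (rank_leq_row _).
(* Nilpotents of ranks at most 2 and 1 need [2 * (2 + 1) + 2 = 8 <= n.+1]. *)
have small N : N != 0 -> N * N = 0 -> (\rank N <= 2)%N -> linked (1 + N) (1 + T).
  move=> N0 N2 rN; apply: (linked_small_rank charFp g1 g3 cop) => //.
  by apply: (@leq_trans (2 * (2 + 1) + 2)%N); rewrite // leq_add2r leq_mul2l leq_add.
exists (1 + T) => X nsX Xp.
have [b [N [d [defX N0 /andP[d0 dp] Nd Nd0]]]] := unip_split nsX Xp.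
have d1 : d = 1%N by apply/eqP; rewrite eqn_leq d0 -ltnS; rewrite p2 in dp; rewrite dp.
rewrite d1 expr2 in Nd.
have b1 : b = 1.
  apply: card2_neq0 => //; apply: contraTneq (nsX) => b0; rewrite /nsunit defX b0 raddf0 add0r.
  apply/nandP; left; apply/negP => uN; case/negP: N0.
  by rewrite -(mulKr uN N) Nd mulr0.
have [rkN | rkN] := leqP (\rank N) 2; first by rewrite defX b1; apply: small.
have [||V [W VW]] := @jordan_basis 2 N 1; rewrite ?expr2 ?expr1 //; first exact: ltnW.
have [||||N'0 sqN' rk lk] := linked_jordan charFp g1 g3 cop (a := b) (N := N) (d := 1) _ _ isT _ _ VW.
- by rewrite -defX.
- by rewrite -defX.
- by rewrite ltnS (leq_trans _ n7).
- by rewrite expr2.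
by rewrite defX; apply: linked_trans lk _; apply: small.
Qed.

End Unipotent.

(** * Semisimple elements *)

Section Derogatory.

Variables (F : finFieldType) (n : nat).
Implicit Types (X N : 'M[F]_n.+1) (g h q : {poly F}).

Lemma separable_XnsubC m (c : F) : m%:R != 0 :> F -> c != 0 -> separable_poly ('X^m - c%:P).
Proof.
case: m => [|m]; first by rewrite eqxx.
move=> m0 c0; rewrite unlock derivB derivC subr0 derivXn -scaler_nat coprimepZr //.
rewrite coprimep_expr // coprimepX rootE !hornerE.
by rewrite expr0n /= sub0r oppr_eq0.
Qed.

Lemma reducible_factor h : (1 < size h)%N -> ~ irreducible_poly h ->
  exists h1 h2, [/\ h = h1 * h2, (1 < size h1 < size h)%N & (1 < size h2 < size h)%N].
Proof.
move=> h1 /irreducibleP; rewrite /irreducibleb h1 /= negb_forall => /existsP[q].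
rewrite negb_imply -ltnNge -Pdiv.Idomain.dvdpE => /andP[qh q1].
have h0 : h != 0 by rewrite -size_poly_gt0 ltnW.
have sqh : (size q < size h)%N by have := size_npoly q; rewrite -ltnS (ltn_predK h1).
move: (polyn q) qh q1 sqh => {}q qh q1 sqh.
have := divpK qh; set r := h %/ q => defh; rewrite mulrC in defh.
have q0 : q != 0 by rewrite -size_poly_gt0 ltnW.
have r0 : r != 0 by apply: contraNneq h0 => r0; rewrite -defh r0 mulr0.
have sh : size h = (size q + size r).-1 by rewrite -defh size_mul.
exists q, r; rewrite q1 sqh; split=> //.
move: sqh q1; rewrite sh; move: (size q) (size r) => a b; lia.
Qed.

(** Under a coprime factorization degrees add and kernel ranks at most add, so an excess of rank
    over degree survives in some irreducible factor. *)
Lemma kermxpoly_irreducible X h :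
  separable_poly h -> ((size h).-1 < \rank (kermxpoly X h))%N ->
  exists g, [/\ irreducible_poly g, g %| h & ((size g).-1 < \rank (kermxpoly X g))%N].
Proof.
have [s] := ubnP (size h); elim: s h => // s IHs h; rewrite ltnS => hs seph rkh.
have h0 := separable_poly_neq0 seph.
have [h1|h1] := leqP (size h) 1.
  move: rkh; have /size_poly1P[c c0 ->] : size h == 1%N.
    by rewrite eqn_leq h1 size_poly_gt0.
  by rewrite kermxpolyC // mxrank0.
have [/irreducibleP irrh|] := boolP (irreducibleb h).
  by exists h.
move/irreducibleP/(reducible_factor h1) => [p1 [p2 [defh /andP[s1 s1h] /andP[s2 s2h]]]].
have cop : coprimep p1 p2 by apply: (separable_coprime seph); rewrite defh.
have sz : size h = (size p1 + size p2).-1.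
  by rewrite defh size_mul // -size_poly_gt0 ltnW.
have rk : (\rank (kermxpoly X h) <= \rank (kermxpoly X p1) + \rank (kermxpoly X p2))%N.
  rewrite defh (kermxpolyM _ cop); exact: (mxrank_adds_leqif _ _).
have sub q : q %| h -> (size q < size h)%N -> ((size q).-1 < \rank (kermxpoly X q))%N ->
    exists g, [/\ irreducible_poly g, g %| h & ((size g).-1 < \rank (kermxpoly X g))%N].
  move=> qh sq rq; have [//||g [ig gq rg]] := IHs q _ _ rq.
  - exact: leq_trans sq hs.
  - exact: dvdp_separable qh seph.
  by exists g; split=> //; apply: dvdp_trans qh.
have [r1|r1] := ltnP (size p1).-1 (\rank (kermxpoly X p1)).
  by apply: sub r1 => //; rewrite defh dvdp_mulr.
apply: (sub p2) => //; first by rewrite defh dvdp_mull.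
move: rkh rk r1; rewrite sz; move: (\rank _) (\rank (kermxpoly X p1)) (\rank (kermxpoly X p2)) (size p1) (size p2) s1 s2.
by move=> a b c d e; clear; lia.
Qed.

Lemma mulmx_horner (v : 'rV[F]_n.+1) X d (u : 'rV[F]_d) :
  v *m horner_mx X (rVpoly u) = u *m \matrix_(i < d) (v *m X ^+ i).
Proof.
rewrite [u *m _]mulmx_sum_row [rVpoly u]poly_def linear_sum mulmx_sumr; apply: eq_bigr => i _.
by rewrite rowK valK linearZ /= rmorphXn /= horner_mx_X scalemxAr.
Qed.

Lemma mulmx_horner_mod (v : 'rV[F]_n.+1) X g q : g != 0 -> v *m horner_mx X g = 0 ->
  v *m horner_mx X q = poly_rV (q %% g) *m \matrix_(i < (size g).-1) (v *m X ^+ i).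
Proof.
move=> g0 vg; rewrite -mulmx_horner poly_rV_K.
  by rewrite {1}(divp_eq q g) mulrC rmorphD rmorphM /= mulmxDr mulmxA vg mul0mx add0r.
by rewrite -ltnS prednK ?size_poly_gt0 // ltn_modp.
Qed.

(** Some irreducible factor [g] of the minimal polynomial has a kernel of dimension above its
    degree, hence two independent cyclic subspaces, spanned by [M v] and [M w]. The wanted map sends
    the first to the second and kills the second. *)
Lemma commuting_nilpotent X m (f : {poly F}) :
  X \in unitmx -> is_scalar_mx (X ^+ m) -> m%:R != 0 :> F ->
  f != 0 -> horner_mx X f = 0 -> (size f <= n.+1)%N ->
  exists N, [/\ N != 0, N * N = 0 & X * N = N * X].
Proof.
move=> uX /is_scalar_mxP[c Xm] m0 f0 Xf sf.
have c0 : c != 0.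
  by apply: contraTneq (unitmx_exp m uX) => c0; rewrite Xm c0 raddf0 unitr0.
have sepX : separable_poly (mxminpoly X).
  apply: dvdp_separable (separable_XnsubC m0 c0); apply: mxminpoly_min.
  by rewrite rmorphB rmorphXn /= horner_mx_X horner_mx_C Xm subrr.
have [|g [irrg _ rkg]] := @kermxpoly_irreducible X _ sepX.
  rewrite /kermxpoly mx_root_minpoly mxrank_ker mxrank0 subn0 size_mxminpoly /= -ltnS.
  by rewrite -size_mxminpoly; apply: leq_trans sf; apply: dvdp_leq; rewrite ?mxminpoly_min.
have g0 := irredp_neq0 irrg; set d := (size g).-1 in rkg.
set K := kermxpoly X g in rkg.
have inK (v : 'rV_n.+1) : (v <= K)%MS -> v *m horner_mx X g = 0 by move/sub_kermxP.
pose M (v : 'rV[F]_n.+1) := \matrix_(i < d) (v *m X ^+ i).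
pose C : 'M[F]_d := \matrix_(i < d) poly_rV ('X^(i.+1) %% g).
have MX v : (v <= K)%MS -> M v *m X = C *m M v.
  move/inK => vg; apply/row_matrixP=> i; rewrite !row_mul !rowK.
  by rewrite -(mulmx_horner_mod _ g0 vg) rmorphXn /= horner_mx_X exprSr -mulmxA.
have K0 : K != 0 by rewrite -mxrank_eq0 -lt0n (leq_ltn_trans _ rkg).
pose v := nz_row K; have v0 : v != 0 by rewrite nz_row_eq0.
have vK : (v <= K)%MS := nz_row_sub K.
have /row_subPn[i] : ~~ (K <= M v)%MS.
  by apply/negP => /mxrankS; rewrite leqNgt (leq_ltn_trans (rank_leq_row _) rkg).
set w := row i K => wM; have wK : (w <= K)%MS by apply: row_sub.
(* Since [g] is irreducible, a nonzero polynomial of lower degree acts invertibly on [K]; this makes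
   the two cyclic subspaces independent. *)
have inv (u : 'rV[F]_d) : u != 0 -> exists q, forall x : 'rV_n.+1, (x <= K)%MS ->
    x *m (horner_mx X (rVpoly u) *m horner_mx X q) = x.
  move=> u0; have : coprimep g (rVpoly u).
    rewrite irreducible_poly_coprime //; apply/negP => /dvdp_leq.
    have -> : rVpoly u != 0.
      by apply: contraNneq u0 => ru0; rewrite -[u]rVpolyK ru0 raddf0.
    move/(_ isT); rewrite leqNgt => /negP[].
    by rewrite -[size g]prednK ?size_poly_gt0 // ltnS size_poly.
  case/Bezout_eq1_coprimepP => [[a q]] /= e; exists q => x /inK xg.
  have {2}-> : x = x *m horner_mx X 1 by rewrite rmorph1 (mulmx1 x : x *m 1 = x).
  rewrite -e (mulrC a) rmorphD !rmorphM /= mulmxDr -!mulmxE (mulmxA x (horner_mx X g)) xg mul0mx add0r.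
  by congr (_ *m _); apply: comm_horner_mx2.
have MvX x q : (x <= K)%MS -> (x *m horner_mx X q <= M x)%MS.
  by move/inK => xg; rewrite (mulmx_horner_mod _ g0 xg) submxMl.
have frM : row_free (col_mx (M v) (M w)).
  apply: inj_row_free => u; rewrite -[u]hsubmxK mul_row_col.
  move: (lsubmx u) (rsubmx u) => a b; rewrite -!mulmx_horner => eab.
  have b0 : b = 0.
    apply/eqP; apply: contraNT wM => /inv[q qK].
    rewrite -(qK w wK) mulmxA.
    have -> : w *m horner_mx X (rVpoly b) = - (v *m horner_mx X (rVpoly a)).
      by apply/eqP; rewrite -addr_eq0 addrC eab.
    by rewrite mulNmx eqmx_opp -mulmxA mulmxE -rmorphM MvX.
  rewrite b0 !raddf0 addr0 in eab.
  have a0 : a = 0.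
    apply/eqP; apply: contraNT v0 => /inv[q qK].
    by rewrite -(qK v vK) mulmxA eab mul0mx.
  by rewrite a0 b0 row_mx0.
have [W [vW wW]] : exists W : 'M[F]_(n.+1, d), M v *m W = 1%:M /\ M w *m W = 0.
  exists (pinvmx (col_mx (M v) (M w)) *m col_mx 1%:M 0).
  by apply: eq_col_mx; rewrite -mul_col_mx mulmxA mulmxVp // mul1mx.
(* Averaging over the powers of [X] turns [W *m M w], which sends [M v] to [M w] and kills
   [M w], into a map commuting with [X] with the same two properties, up to a scalar. *)
pose N : 'M[F]_n.+1 := \sum_(i < m) X ^+ (m - i) *m (W *m M w) *m X ^+ i.
have MwX j : (M w *m X ^+ j <= M w)%MS.
  elim: j => [|j IHj]; first by rewrite expr0 (mulmx1 (M w) : M w *m 1 = M w).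
  rewrite exprSr -[_ * X]/(_ *m _) mulmxA; apply: submx_trans (submxMr _ IHj) _.
  by rewrite MX // submxMl.
have CX j x : (x <= K)%MS -> M x *m X ^+ j = C ^+ j *m M x.
  move=> xK; elim: j => [|j IHj].
    by rewrite !expr0 (mulmx1 (M x) : M x *m 1 = M x) (mul1mx (M x) : 1 *m M x = M x).
  rewrite exprSr -[_ * X]/(_ *m _) mulmxA IHj -mulmxA MX // mulmxA.
  by rewrite exprSr -[_ * C]/(_ *m _).
have MwN : M w *m N = 0.
  rewrite mulmx_sumr big1 // => i' _; rewrite !mulmxA.
  have /submxP[D ->] := MwX (m - i')%N.
  by rewrite -(mulmxA D) wW mulmx0 !mul0mx.
have MvN : M v *m N = (m%:R * c) *: M w.
  rewrite mulmx_sumr (eq_bigr (fun=> c *: M w)) => [|i' _].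
    by rewrite sumr_const card_ord -scaler_nat scalerA.
  rewrite !mulmxA CX // -(mulmxA _ (M v)) vW mulmx1 -mulmxA CX // mulmxA.
  rewrite -[_ *m C ^+ i']/(_ * _) -exprD subnK ?(ltnW (ltn_ord i')) // -CX // Xm.
  by rewrite mul_mx_scalar.
have Mw0 : M w != 0.
  apply: contraNneq wM => Mw0; have := MvX w 1 wK.
  rewrite rmorph1 (mulmx1 w : w *m 1 = w) => sw.
  by apply: submx_trans sw _; rewrite Mw0 sub0mx.
have sNM : (N <= M w)%MS.
  rewrite /N; apply: (big_ind (fun A : 'M[F]_n.+1 => (A <= M w)%MS)).
  - exact: sub0mx.
  - by move=> A B sA sB; apply: addmx_sub.
  by move=> i' _; rewrite -!mulmxA !(mulmxA _ _ (M w *m _)) mulmx_sub ?MwX.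
exists N; split.
- apply: contraNneq Mw0 => N0; move/eqP: MvN.
  by rewrite N0 mulmx0 eq_sym scaler_eq0 mulf_eq0 (negbTE m0) (negbTE c0).
- by have /submxP[D {1}->] := sNM; rewrite -[LHS]/(_ *m _) -mulmxA MwN mulmx0.
rewrite /N mulr_sumr mulr_suml.
have XN (k j : nat) : X * (X ^+ k *m (W *m M w) *m X ^+ j) = X ^+ k.+1 *m (W *m M w) *m X ^+ j.
  by rewrite exprS -[LHS]/(_ *m _) -[X * X ^+ k]/(_ *m _) !mulmxA.
have NX (k j : nat) : X ^+ k *m (W *m M w) *m X ^+ j * X = X ^+ k *m (W *m M w) *m X ^+ j.+1.
  by rewrite exprSr -[LHS]/(_ *m _) -[X ^+ j * X]/(_ *m _) !mulmxA.
(* The two sums differ by a shift of the index; the extreme terms agree because [X ^+ m] is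
   scalar. *)
under eq_bigr do rewrite XN; under [RHS]eq_bigr do rewrite NX.
case: (m) Xm m0 => [|l] Xm l0; first by rewrite !big_ord0.
rewrite big_ord_recl big_ord_recr /= [RHS]addrC subSnn subn0; congr (_ + _).
  have e1 (A : 'M[F]_n.+1) : A *m 1 = A := mulmx1 A.
  by rewrite (exprS X l.+1) Xm expr0 expr1 e1 mul_mx_scalar -[X * _]/(X *m _) mul_mx_scalar -scalemxAl.
apply: eq_bigr => i' _; rewrite /bump /= add1n subSS -subSn //.
exact: ltnW (ltn_ord i').
Qed.




End Derogatory.

(** * Finite extensions of the base field *)

Section FiniteExtension.

Variables (F : finFieldType) (p : nat).
Hypothesis charFp : p \in [pchar F].
Implicit Types (g h r u : {poly F}).

Lemma expf_card_exp (c : F) j : c ^+ (#|F| ^ j) = c.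
Proof. by elim: j => [|j IHj]; rewrite ?expr1 // expnS exprM expf_card. Qed.

(** The [#|F| ^ j]-th power is additive on [{poly F}] and fixes constants, so fixing the image of
    ['X] is enough. It serves both for residue fields and for algebras generated by a matrix. *)
Lemma frobenius_fixed (R : nzRingType) (h : {rmorphism {poly F} -> R}) j :
  h 'X ^+ (#|F| ^ j) = h 'X -> forall r, h r ^+ (#|F| ^ j) = h r.
Proof.
move=> hX r; set Q := (#|F| ^ j)%N in hX *.
have charP : p \in [pchar {poly F}] by rewrite pchar_poly.
have natQ : [pchar {poly F}].-nat Q.
  rewrite (eq_pnat _ (pcharf_eq charP)) pnatX (card_pnat charFp) //.
elim/poly_ind: r => [|r c IHr]; first by rewrite rmorph0 expr0n expn_eq0 (gtn_eqF (ltnW (finNzRing_gt1 F))).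
rewrite -rmorphXn exprDn_pchar // rmorphD !rmorphXn rmorphM (exprMn_comm _ _).
  by rewrite IHr hX -rmorphXn -polyC_exp expf_card_exp -rmorphM -rmorphD.
by rewrite /GRing.comm -!rmorphM mulrC.
Qed.

Lemma rmorph_comp_poly (R : nzRingType) (h k : {rmorphism {poly F} -> R}) u :
  k 'X = h u -> (forall c, k c%:P = h c%:P) -> forall r, k r = h (r \Po u).
Proof.
move=> kX kC; elim/poly_ind => [|r c IHr]; first by rewrite comp_poly0 !rmorph0.
by rewrite comp_polyD comp_polyM comp_polyX comp_polyC !rmorphD !rmorphM IHr kX kC.
Qed.

End FiniteExtension.

Lemma expf_neq1 (K : finFieldType) k : (0 < k)%N -> (k.+1 < #|K|)%N ->
  exists2 x : K, x != 0 & x ^+ k != 1.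
Proof.
move=> k0 kK; have [/existsP[x /andP[]]|] := boolP [exists x : K, (x != 0) && (x ^+ k != 1)].
  by exists x.
rewrite negb_exists => /forallP allx.
have P0 : ('X^k - 1 : {poly K}) != 0 by rewrite -size_poly_gt0 size_XnsubC.
have := max_poly_roots P0 (rs := enum [set~ (0 : K)]).
rewrite enum_uniq -cardE cardsC1 size_XnsubC // => /(_ _ isT).
rewrite ltnS => H; have : (#|K|.-1 <= k)%N; last first.
  by rewrite leqNgt -ltnS prednK ?kK // (ltn_trans _ kK).
apply: H; apply/allP => x; rewrite mem_enum !inE => x0; have := allx x.
by rewrite x0 negbK rootE !hornerE => /eqP ->; rewrite subrr.
Qed.

(** * The field generated by a root of an irreducible polynomial *)

Section Residue.

Variables (F : finFieldType) (p : nat).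
Hypothesis charFp : p \in [pchar F].
Variables (L : fieldExtType F) (z : L) (g : {poly F}).
Hypotheses (irr_g : irreducible_poly g) (dimL : \dim {:L} = (size g).-1).
Hypotheses (root_z : root (map_poly (in_alg L) g) z) (gen_z : <<1; z>>%VS = fullv).
Implicit Types (r u : {poly F}) (x y : L).

Local Notation ev := (fieldExt_horner z).
Local Notation q := #|F|.
Local Notation d := (size g).-1.

Lemma ev_eq0 r : (ev r == 0) = (g %| r).
Proof.
have evg : ev g = 0 by apply/eqP.
apply/idP/idP => [/eqP er|/dvdpP[u ->]]; last by rewrite rmorphM /= evg mulr0.
apply: contraT; rewrite -irreducible_poly_coprime // => /Bezout_eq1_coprimepP[[u v]] /= e.
by have := oner_neq0 L; rewrite -(rmorph1 ev) -e rmorphD !rmorphM /= er evg !mulr0 addr0 eqxx.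
Qed.

Lemma ev_onto x : exists r, x = ev r.
Proof.
have /Fadjoin1_polyP[r ->] : x \in <<1; z>>%VS by rewrite gen_z memvf.
by exists r.
Qed.

Lemma expr_fieldExt x : x ^+ (q ^ d) = x.
Proof. by apply/eqP; rewrite -dimL -Fermat's_little_theorem memvf. Qed.

Lemma in_alg_exp x : (x \in 1%VS) = (x ^+ q == x).
Proof. by rewrite (Fermat's_little_theorem (aspace1 L)) dimv1 expn1. Qed.

Lemma expr_neq1 k : (0 < k)%N -> (k.+1 < q ^ d)%N -> exists2 x : L, x != 0 & x ^+ k != 1.
Proof.
move=> k0 kq; apply: (@expf_neq1 (finvect_type L)) => //.
have -> : #|finvect_type L| = (q ^ d)%N; last by [].
by rewrite -dimL; have := card_vspace {: finvect_type L}%VS => <-; apply: eq_card => x; rewrite memvf.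
Qed.

(** Otherwise every element of [L] would be fixed by the [q ^ a]-th power, but [x ^+ (q ^ a).-1 = 1]
    has too few solutions. *)
Lemma gen_expr_neq a : (0 < a < d)%N -> z ^+ (q ^ a) != z.
Proof.
case/andP=> a0 ad; apply/eqP => za.
have evX : ev 'X ^+ (q ^ a) = ev 'X by rewrite /= fieldExt_hornerX.
have q1 : (1 < q)%N := finNzRing_gt1 F.
have qa0 : (0 < q ^ a)%N by rewrite expn_gt0 ltnW.
have [||x x0] := @expr_neq1 (q ^ a).-1.
- by rewrite -ltnS prednK // -(exp1n a) ltn_exp2r.
- by rewrite prednK // ltn_exp2l.
have [r xr] := ev_onto x; have /= := frobenius_fixed charFp evX r.
by rewrite -xr -{1}(prednK qa0) exprS => e; rewrite -(inj_eq (mulfI x0)) mulr1 e eqxx.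
Qed.

(** [y] is a power [u ^+ M] lying in the subfield with [q ^ a] elements, and [m] is the exponent of
    the norm from it to [F], so [y ^+ m] is in [F]. *)
Lemma ex_subfield_gen a : (1 < a < d)%N -> (a %| d)%N ->
  let m := ((q ^ a).-1 %/ q.-1)%N in
  exists y c, [/\ y ^+ m = c%:A, y \notin 1%VS, <<1; y>>%VS != fullv & y ^+ (q ^ a) = y].
Proof.
case/andP=> a1 ad advd m; have q1 : (1 < q)%N := finNzRing_gt1 F.
have qa0 b : (0 < q ^ b)%N by rewrite expn_gt0 ltnW.
have dvdq b e : (b %| e)%N -> ((q ^ b).-1 %| (q ^ e).-1)%N.
  case/dvdnP=> l ->; rewrite mulnC expnM -!subn1.
  by rewrite -{2}(exp1n l) subn_exp dvdn_mulr.
have dqa := dvdq _ _ advd; have dq1 : (q.-1 %| (q ^ a).-1)%N by rewrite -{1}(expn1 q) dvdq.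
pose M := ((q ^ d).-1 %/ (q ^ a).-1)%N.
have q'0 b : (0 < b)%N -> (0 < (q ^ b).-1)%N.
  by move=> b0; rewrite -ltnS prednK // -(exp1n b) ltn_exp2r.
have a0 : (0 < a)%N := ltnW a1; have d0 : (0 < d)%N := ltn_trans a0 ad.
have M0 : (0 < M)%N.
  rewrite divn_gt0; last exact: q'0.
  by apply: dvdn_leq dqa; apply: q'0.
(* This choice keeps [y = u ^+ M] out of [F], whose units have [q.-1]-st power 1. *)
have [||u u0 uM] := @expr_neq1 (M * q.-1).
- by rewrite muln_gt0 M0 -{1}(expn1 q) q'0.
- apply: (@leq_trans (M * (q ^ a).-1).+1); last by rewrite divnK // prednK.
  rewrite ltnS ltn_pmul2l // -ltnS !prednK ?(ltnW q1) //.
  by rewrite -{1}(expn1 q) ltn_exp2l.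
pose y := u ^+ M.
have ya : y ^+ (q ^ a).-1 = 1.
  apply: (mulfI u0); rewrite -exprM divnK // -exprS prednK // mulr1.
  exact: expr_fieldExt.
have yqa : y ^+ (q ^ a) = y by rewrite -(prednK (qa0 a)) exprSr ya mul1r.
have yF : y \notin 1%VS.
  rewrite in_alg_exp; apply: contra uM => /eqP yq.
  have y0 : y != 0 by rewrite expf_neq0.
  by rewrite exprM -/y -(inj_eq (mulfI y0)) -exprS prednK ?yq ?mulr1 // ltnW.
have /vlineP[c ymc] : y ^+ m \in 1%VS.
  rewrite in_alg_exp -{1}(prednK (ltnW q1)) exprSr -exprM divnK // ya mul1r eqxx //.
exists y, c; split=> //; apply/eqP => genY.
have evX : fieldExt_horner y 'X ^+ (q ^ a) = fieldExt_horner y 'X by rewrite /= fieldExt_hornerX.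
have /Fadjoin1_polyP[r zr] : z \in <<1; y>>%VS by rewrite genY memvf.
have := @gen_expr_neq a; rewrite ad a0 => /(_ isT); rewrite [z]zr.
by have /= -> := frobenius_fixed charFp evX r; rewrite eqxx.
Qed.

End Residue.

(** * Linking elements of order prime to the characteristic to the hub *)

Section Semisimple.

Variables (F : finFieldType) (n p : nat) (T : 'M[F]_n.+1).
Hypotheses (charFp : p \in [pchar F]) (hubT : hub p T).
Implicit Types (X Y N : 'M[F]_n.+1) (g h r u : {poly F}).

Let p_prime : prime p := pcharf_prime charFp.

Lemma natr_neq0_coprime m : coprime m p -> m%:R != 0 :> F.
Proof. by rewrite -(dvdn_pcharf charFp) coprime_sym prime_coprime. Qed.

Lemma linked_derogatory Y m (f : {poly F}) : nsunit Y -> is_scalar_mx (Y ^+ m) ->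
  coprime m p -> f != 0 -> horner_mx Y f = 0 -> (size f <= n.+1)%N -> linked Y T.
Proof.
move=> nsY Ym mp f0 Yf sf; have [uY _] := andP nsY.
have [N [N0 N2 YN]] := commuting_nilpotent uY Ym (natr_neq0_coprime mp) f0 Yf sf.
have N1p : is_scalar_mx ((1 + N) ^+ p) by rewrite (unip_expp charFp) // scalar_mx_is_scalar.
have nsN := nsunit_unip charFp N0 N2.
apply: linked_trans (hubT nsN N1p); apply: linked_coprime Ym N1p mp => //.
by rewrite mulrDr mulrDl mulr1 mul1r YN.
Qed.

Lemma mxminpoly_separable X m : X \in unitmx -> is_scalar_mx (X ^+ m) -> coprime m p ->
  separable_poly (mxminpoly X).
Proof.
move=> uX /is_scalar_mxP[c Xm] mp.
have c0 : c != 0.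
  by apply: contraTneq (unitmx_exp m uX) => c0; rewrite Xm c0 raddf0 unitr0.
apply: dvdp_separable (separable_XnsubC (natr_neq0_coprime mp) c0); apply: mxminpoly_min.
by rewrite rmorphB rmorphXn /= horner_mx_X horner_mx_C Xm subrr.
Qed.

Lemma crt_poly g h r u : coprimep g h -> exists v, g %| v - r /\ h %| v - u.
Proof.
case/Bezout_eq1_coprimepP=> [[a b]] /= e.
exists (r * (b * h) + u * (a * g)); split.
  rewrite -[X in _ - X]mulr1 -e.
  have -> : r * (b * h) + u * (a * g) - r * (a * g + b * h) = (u - r) * a * g by ring.
  exact: dvdp_mull.
rewrite -[X in _ - X]mulr1 -e.
have -> : r * (b * h) + u * (a * g) - u * (a * g + b * h) = (r - u) * b * h by ring.
exact: dvdp_mull.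
Qed.

Section Residue.

Variables (X : 'M[F]_n.+1) (s : nat) (g h : {poly F}).
Hypotheses (nsX : nsunit X) (Xs : is_scalar_mx (X ^+ s)) (s_prime : prime s) (sp : coprime s p).
Hypotheses (minX : mxminpoly X = g * h) (size_minX : size (mxminpoly X) = n.+2).
Hypothesis irr_g : irreducible_poly g.
Variables (L : fieldExtType F) (z : L).
Hypotheses (dimL : \dim {:L} = (size g).-1).
Hypotheses (root_z : root (map_poly (in_alg L) g) z) (gen_z : <<1; z>>%VS = fullv).

Local Notation q := #|F|.
Local Notation d := (size g).-1.

Lemma coprime_minX : coprimep g h.
Proof.
have [uX _] := andP nsX; have := mxminpoly_separable uX Xs sp.
by move=> sep; apply: separable_coprime sep _; rewrite minX.
Qed.

Lemma factor_neq0 : g != 0 /\ h != 0.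
Proof.
have : mxminpoly X != 0 by rewrite monic_neq0 ?mxminpoly_monic.
by rewrite minX mulf_eq0 => /norP.
Qed.

Lemma size_minX_factors : (d + (size h).-1 = n.+1)%N.
Proof.
have [g0 h0] := factor_neq0.
move: size_minX; rewrite minX size_mul //; move: g0 h0; rewrite -!size_poly_gt0.
by clear; move: (size g) (size h); lia.
Qed.

(* The linking element is the polynomial in [X] that acts as [y] on the kernel of [g] and as
   the identity on that of [h]. *)
Lemma linked_residue (y : L) m c : y ^+ m = c%:A -> (c == 1) || (size h == 1%N) ->
  coprime m s -> coprime m p -> y \notin 1%VS ->
  (\dim <<1; y>> + (size h != 1%N) < n.+1)%N -> linked X T.
Proof.
move=> ym c1 ms mp y1 dimy; have [uX _] := andP nsX.
have y0 : y != 0 by apply: contraNneq y1 => ->; rewrite mem0v.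
have [r yr] := ev_onto gen_z y.
have [P [gP hP]] := crt_poly r 1 coprime_minX.
have evP : fieldExt_horner z P = y.
  apply/eqP; rewrite yr -subr_eq0 -rmorphB /=.
  by rewrite (ev_eq0 irr_g root_z).
pose Y := horner_mx X P.
have horner0 u : g %| u -> h %| u -> horner_mx X u = 0.
  move=> gu hu; apply/mxminpoly_minP; rewrite minX Gauss_dvdp ?gu ?hu //.
  exact: coprime_minX.
(* [Y] is the identity on the kernel of [h], hence the requirement that [c = 1] or [h] be
   constant. *)
have YmE : Y ^+ m = c%:M.
  apply/eqP; rewrite -subr_eq0 -(horner_mx_C X) -rmorphXn -rmorphB /=; apply/eqP.
  apply: horner0.
    rewrite -(ev_eq0 irr_g root_z) rmorphB rmorphXn /= evP fieldExt_hornerC ym.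
    by rewrite subrr.
  case/orP: c1 => [/eqP ->|]; last by rewrite size_poly_eq1 => /eqp_dvdl ->; apply: dvd1p.
  rewrite polyC1 -(expr1n _ m) subrXX; exact: dvdp_mulr.
have m0 : (0 < m)%N.
  by case: (m) mp => //; rewrite /coprime gcd0n => /eqP p1; have := p_prime; rewrite p1.
have c0 : c != 0.
  by apply/eqP => c0; have := expf_neq0 m y0; rewrite ym c0 scale0r eqxx.
have uY : Y \in unitmx.
  rewrite -[_ \in unitmx]/(Y \is a GRing.unit) -(unitrX_pos _ m0).
  by rewrite YmE -[_ \is a _]/(_ \in unitmx) unitmxE det_scalar unitfE expf_neq0.
have nsY : nsunit Y.
  rewrite /nsunit uY; apply/is_scalar_mxP => [[b Yb]].
  have : g %| P - b%:P.
    apply: (@dvdp_trans _ (mxminpoly X)); first by rewrite minX dvdp_mulr.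
    by apply: mxminpoly_min; rewrite rmorphB /= horner_mx_C -Yb subrr.
  rewrite -(ev_eq0 irr_g root_z) rmorphB /= evP fieldExt_hornerC subr_eq0 => /eqP yb.
  by case/negP: y1; rewrite yb memvZ // mem1v.
apply: (@linked_trans _ _ Y).
  apply: (linked_coprime (l := m) nsX nsY _ Xs).
  - by rewrite -[LHS]/(_ *m _); apply: comm_mx_horner.
  - by rewrite YmE; apply: scalar_mx_is_scalar.
  - by rewrite coprime_sym.
have [mu defmu] : exists mu, minPoly 1 y = map_poly (in_alg L) mu.
  by have /polyOver1P[mu ->] := minPolyOver 1 y; exists mu.
have smu : size mu = (\dim <<1; y>>).+1.
  by rewrite -(size_map_poly (in_alg L)) -defmu size_minPoly adjoin_degreeE dimv1 divn1.
(* [t] accounts for the eigenvalue 1 of [Y] on the kernel of [h], absent when [h] is constant;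
   [mu * t] then annihilates [Y]. *)
pose t : {poly F} := if size h == 1%N then 1 else 'X - 1.
have t0 : t != 0 by rewrite /t; case: ifP; rewrite ?oner_eq0 // -polyC1 polyXsubC_eq0.
have mu0 : mu != 0 by rewrite -size_poly_gt0 smu.
apply: (linked_derogatory nsY (m := m) (f := mu * t)) => //.
- by rewrite YmE scalar_mx_is_scalar.
- by rewrite mulf_neq0.
- have compX u : horner_mx Y u = horner_mx X (u \Po P).
    by apply: rmorph_comp_poly => [|b]; rewrite /= ?horner_mx_X ?horner_mx_C.
  have compz u : fieldExt_horner y u = fieldExt_horner z (u \Po P).
    by apply: rmorph_comp_poly => [|b]; rewrite /= ?fieldExt_hornerX ?fieldExt_hornerC ?evP.
  rewrite compX comp_polyM; apply: horner0.
    apply: dvdp_mulr; rewrite -(ev_eq0 irr_g root_z) -compz.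
    by rewrite [fieldExt_horner y mu]/(map_poly (in_alg L) mu).[y] -defmu; apply/eqP; apply: minPolyxx.
  apply: dvdp_mull; rewrite /t; case: ifP => [|_]; last by rewrite comp_polyB comp_polyX -polyC1 comp_polyC polyC1.
  by rewrite size_poly_eq1 => /eqp_dvdl ->; apply: dvd1p.
rewrite size_mul // smu /= (leq_trans _ dimy) // /t; case: ifP => _ /=.
  by rewrite size_poly1 addn0 addn1.
by rewrite -polyC1 size_XsubC addn1 addn2.
Qed.


Lemma dim_proper_adjoin (y : L) : <<1; y>>%VS != fullv -> (\dim <<1; y>> < d)%N.
Proof. by move=> yN; rewrite -dimL ltn_neqAle dimvS ?subvf // (dimv_leqif_eq (subvf _)) yN. Qed.

(** The subfield element [y] generates less than [L], which brings the degree below [n.+1]. When [h]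
    is not constant the scalar [y ^+ m] has to be 1, which is automatic for [q = 2]. *)
Lemma linked_subfield a : (1 < a < d)%N -> (a %| d)%N -> (size h == 1%N) || (q == 2%N) ->
  linked X T.
Proof.
move=> ad advd hq2; have q1 : (1 < q)%N := finNzRing_gt1 F.
have [a1 a_lt_d] := andP ad; have a0 : (0 < a)%N := ltnW a1.
have [y [c [ym y1 yN yqa]]] := ex_subfield_gen charFp dimL gen_z ad advd.
set m := (_ %/ _)%N in ym.
have qa0 : (0 < q ^ a)%N by rewrite expn_gt0 ltnW.
have dvdm : (q.-1 %| (q ^ a).-1)%N.
  by rewrite -!subn1 -{2}(exp1n a) subn_exp dvdn_mulr.
have mq : (m * q.-1 = (q ^ a).-1)%N by rewrite /m divnK.
have y0 : y != 0 by apply: contraNneq y1 => ->; rewrite mem0v.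
apply: (linked_residue ym _ _ _ y1).
- case/orP: hq2 => [->|/eqP q2]; first by rewrite orbT.
  rewrite (card2_neq0 (a := c) q2) ?eqxx //; apply/eqP => c0.
  by have := expf_neq0 m y0; rewrite ym c0 scale0r eqxx.
(* If [s] divided [m], then [z ^+ (q ^ a).-1] would be a power of [b ^+ q.-1 = 1], and [z] would be
   fixed by the [q ^ a]-th power. *)
- rewrite coprime_sym prime_coprime //; apply/negP => /dvdnP[l defm].
  have [uX _] := andP nsX; have /is_scalar_mxP[b Xb] := Xs.
  have b0 : b != 0.
    by apply: contraTneq (unitmx_exp s uX) => b0; rewrite Xb b0 raddf0 unitr0.
  have zs : z ^+ s = b%:A.
    have : g %| 'X^s - b%:P.
      apply: (@dvdp_trans _ (mxminpoly X)); first by rewrite minX dvdp_mulr.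
      by apply: mxminpoly_min; rewrite rmorphB rmorphXn /= horner_mx_X horner_mx_C Xb subrr.
    rewrite -(ev_eq0 irr_g root_z) rmorphB rmorphXn /= fieldExt_hornerX fieldExt_hornerC.
    by rewrite subr_eq0 => /eqP.
  have bq : b ^+ q.-1 = 1.
    by apply: (mulfI b0); rewrite -exprS prednK ?expf_card ?mulr1 // ltnW.
  have zqa : z ^+ (q ^ a).-1 = 1.
    rewrite -mq defm mulnAC mulnC mulnA !exprM zs -[_ ^+ l ^+ _]exprM mulnC exprM.
    by rewrite -(rmorphXn (in_alg L)) bq rmorph1 expr1n.
  have := @gen_expr_neq _ _ charFp _ _ _ dimL gen_z a; rewrite a0 a_lt_d => /(_ isT).
  by rewrite -(prednK qa0) exprS zqa mulr1 eqxx.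
- by apply: coprime_dvdl (coprime_card_pred charFp a0); rewrite -mq dvdn_mulr.
have := dim_proper_adjoin yN; have := size_minX_factors; have [_] := factor_neq0.
by rewrite -size_poly_gt0; clear; move: (\dim _) (size h) d; lia.
Qed.

(** An element of order [t] of the residue field serves. It may generate the whole field: the degree
    [d + 1] is still below [n.+1] because [h] has degree at least 2. *)
Lemma linked_prime_order t : q = 2%N -> prime t -> t != s -> (t %| (q ^ d).-1)%N ->
  (1 < (size h).-1)%N -> linked X T.
Proof.
move=> q2 t_pr ts tq sh; have q1 : (1 < q)%N := finNzRing_gt1 F.
have t1 := prime_gt1 t_pr; have d0 : (0 < d)%N.
  by have [sg _] := irr_g; rewrite -ltnS prednK // ltnW.
have qd1 : (1 < q ^ d)%N by rewrite -(exp1n d) ltn_exp2r.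
have qd0 : (0 < (q ^ d).-1)%N by rewrite -ltnS prednK // ltnW.
pose k := ((q ^ d).-1 %/ t)%N.
have k0 : (0 < k)%N by rewrite divn_gt0 ?prime_gt0 // dvdn_leq.
have kq : (k.+1 < q ^ d)%N.
  by rewrite -(prednK (ltnW qd1)) ltnS ltn_Pdiv.
have [u u0 uk] := expr_neq1 dimL k0 kq.
have yt : (u ^+ k) ^+ t = 1%:A.
  rewrite -exprM divnK // scale1r; apply: (mulfI u0); rewrite mulr1 -exprS prednK ?(ltnW qd1) //.
  exact: expr_fieldExt.
apply: (linked_residue yt); rewrite ?eqxx //.
- by rewrite prime_coprime // dvdn_prime2.
- exact: coprime_dvdl tq (coprime_card_pred charFp d0).
- apply: contra uk => /vlineP[c uc]; rewrite uc.
  have c0 : c != 0.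
    by apply/eqP => c0; have := expf_neq0 k u0; rewrite uc c0 scale0r eqxx.
  by rewrite (card2_neq0 q2 c0) scale1r.
have : (\dim <<1; u ^+ k>> <= d)%N by rewrite -dimL dimvS // subvf.
have := size_minX_factors; move: sh; clear; move: (\dim _) (size h) d.
by move=> e l r; lia.
Qed.

End Residue.

Lemma size_mxminpoly_le X : (size (mxminpoly X) <= n.+2)%N.
Proof.
rewrite -(size_char_poly X) dvdp_leq ?mxminpoly_dvd_char //.
by rewrite monic_neq0 ?char_poly_monic.
Qed.

(** Size [n.+2] is degree [n.+1]: the minimal polynomial is then the characteristic one. *)
Lemma linked_or_cyclic X m : nsunit X -> is_scalar_mx (X ^+ m) -> coprime m p ->
  linked X T \/ size (mxminpoly X) = n.+2.
Proof.
move=> nsX Xm mp; have [sX|sX] := leqP (size (mxminpoly X)) n.+1; last first.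
  by right; apply/eqP; rewrite eqn_leq size_mxminpoly_le.
left; apply: (linked_derogatory nsX Xm mp) sX.
  by rewrite monic_neq0 ?mxminpoly_monic.
exact: mx_root_minpoly.
Qed.

Lemma mxminpoly_factor_order X m : X \in unitmx -> is_scalar_mx (X ^+ m) -> (0 < m)%N ->
  exists2 c, c != 0 & (mxminpoly X %| 'X^m - c%:P) && ((size (mxminpoly X)).-1 <= m)%N.
Proof.
move=> uX /is_scalar_mxP[c Xm] m0; exists c.
  by apply: contraTneq (unitmx_exp m uX) => c0; rewrite Xm c0 raddf0 unitr0.
have div : mxminpoly X %| 'X^m - c%:P.
  by apply: mxminpoly_min; rewrite rmorphB rmorphXn /= horner_mx_X horner_mx_C Xm subrr.
rewrite div /=; have := dvdp_leq _ div; rewrite size_XnsubC // => H.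
by rewrite -subn1 leq_subLR add1n H // -size_poly_gt0 size_XnsubC.
Qed.

(* A prime [t != s] dividing [q - 1] provides an element of order [t] of [F] with which
   the two factors of a reducible minimal polynomial are told apart. *)
Lemma linked_reducible X s t : nsunit X -> is_scalar_mx (X ^+ s) -> prime s -> coprime s p ->
  (2 <= n)%N -> (1 < #|F|.-1)%N -> prime t -> t != s -> (t %| #|F|.-1)%N ->
  ~ irreducible_poly (mxminpoly X) -> linked X T.
Proof.
move=> nsX Xs s_pr sp n2 q2 t_pr ts tq redX; have [uX nscX] := andP nsX.
have m1 : (1 < size (mxminpoly X))%N by rewrite size_mxminpoly ltnS mxminpoly_nonconstant.
have [g [h [minX /andP[sg _] /andP[sh _]]]] := reducible_factor m1 redX.
have cop : coprimep g h by apply: separable_coprime (mxminpoly_separable uX Xs sp) _; rewrite minX.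
have q1 : (1 < #|F|)%N := finNzRing_gt1 F; have t1 := prime_gt1 t_pr.
pose k := (#|F|.-1 %/ t)%N.
have k0 : (0 < k)%N by rewrite divn_gt0 ?prime_gt0 // dvdn_leq // ltnW.
have [u u0 uk] : exists2 u : F, u != 0 & u ^+ k != 1.
  by apply: expf_neq1 => //; rewrite -(prednK (ltnW q1)) ltnS ltn_Pdiv // ltnW.
set b := u ^+ k in uk.
have bt : b ^+ t = 1.
  by apply: (mulfI u0); rewrite -exprM divnK // -exprS prednK ?expf_card ?mulr1 // ltnW.
have [P [gP hP]] := crt_poly b%:P 1 cop.
have horner0 v : g %| v -> h %| v -> horner_mx X v = 0.
  by move=> gv hv; apply/mxminpoly_minP; rewrite minX Gauss_dvdp ?gv.
pose Y := horner_mx X P.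
have Yt : Y ^+ t = 1.
  apply/eqP; rewrite -subr_eq0 -(rmorph1 (horner_mx X)) -rmorphXn -rmorphB /=; apply/eqP.
  apply: horner0; last by rewrite -(expr1n _ t) subrXX; apply: dvdp_mulr.
  by rewrite -polyC1 -bt polyC_exp subrXX; apply: dvdp_mulr.
have uY : Y \in unitmx by apply: unit_of_exp Yt; apply: prime_gt0.
have nsY : nsunit Y.
  rewrite /nsunit uY; apply/is_scalar_mxP => [[e Ye]].
  have : mxminpoly X %| P - e%:P.
    by apply: mxminpoly_min; rewrite rmorphB /= horner_mx_C -Ye subrr.
  have const (v : {poly F}) (c : F) : (1 < size v)%N -> v %| c%:P -> c = 0.
    move=> sv vc; apply/eqP; apply: contraLR sv => c0; rewrite -leqNgt.
    by apply: leq_trans (dvdp_leq _ vc) (size_polyC_leq1 _); rewrite polyC_eq0.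
  rewrite minX Gauss_dvdp // => /andP[ge he]; case/eqP: uk.
  have := dvdp_sub gP ge; rewrite opprB addrC addrA addrNK -polyCB => /(const _ _ sg)/eqP.
  rewrite subr_eq0 => /eqP <-.
  have := dvdp_sub hP he; rewrite opprB addrC addrA addrNK -polyC1 -polyCB => /(const _ _ sh)/eqP.
  by rewrite subr_eq0 => /eqP.
have st : coprime s t by rewrite prime_coprime // dvdn_prime2 // eq_sym.
have Yts : is_scalar_mx (Y ^+ t) by rewrite Yt scalar_mx_is_scalar.
apply: (@linked_trans _ _ Y).
  by apply: linked_coprime nsX nsY _ Xs Yts st; rewrite -[LHS]/(_ *m _); apply: comm_mx_horner.
have tp : coprime t p.
  by apply: coprime_dvdl tq _; rewrite -(expn1 #|F|) coprime_card_pred.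
apply: (linked_derogatory nsY Yts tp (f := ('X - b%:P) * ('X - 1))).
- by rewrite mulf_neq0 // -?polyC1 polyXsubC_eq0.
- have compX v : horner_mx Y v = horner_mx X (v \Po P).
    by apply: rmorph_comp_poly => [|c]; rewrite /= ?horner_mx_X ?horner_mx_C.
  rewrite compX comp_polyM !comp_polyB comp_polyX -polyC1 !comp_polyC polyC1.
  by apply: horner0; [apply: dvdp_mulr | apply: dvdp_mull].
by rewrite -polyC1 size_mul ?polyXsubC_eq0 // !size_XsubC.
Qed.

End Semisimple.

(** * Prime powers of the form [2 ^ e - 1] *)

Section Arithmetic.

(** Binomial expansion modulo [x ^+ 2]; with [x = s + 1] it gives the cofactor of [s + 1] in
    [s ^ k + 1] modulo [s + 1]. *)
Lemma exp_odd_mod_sqr (x : int) k : odd k ->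
  exists m : int, (x - 1) ^+ k = k%:Z * x - 1 + m * x ^+ 2.
Proof.
move=> ok; rewrite -(odd_double_half k) ok add1n.
elim: (k./2) => [|j [m IHj]]; first by exists 0; rewrite expr1 /= mul0r addr0 mul1r.
exists (j.*2.+1%:Z * x - j.*2.+1%:Z *+ 2 - 1 + m * (x - 1) ^+ 2).
by rewrite doubleS 2!exprS IHj -[j.*2.+3]addn2 PoszD; ring.
Qed.

(** Modulo 4, [k] is odd, so [s + 1] divides [s ^ k + 1 = 2 ^ e] and is some [2 ^ i]. If [i = e]
    then [k = 1]; otherwise the cofactor is even, although it is congruent to the odd [k] modulo the
    even number [s + 1]. *)
Lemma mersenne_prime_power e s k : prime s -> (1 < e)%N -> (2 ^ e).-1 = (s ^ k)%N -> k = 1%N.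
Proof.
move=> s_pr e1 es; have s1 := prime_gt1 s_pr.
have e0 : (0 < 2 ^ e)%N by rewrite expn_gt0.
have es' : (s ^ k + 1 = 2 ^ e)%N by rewrite -es addn1 prednK.
have k0 : (0 < k)%N.
  rewrite lt0n; apply/negP => /eqP k0; have : (2 ^ 2 <= 2 ^ e)%N by rewrite leq_exp2l.
  by rewrite -es' k0.
have even_2e : ~~ odd (2 ^ e) by rewrite oddX /= orbF -lt0n ltnW.
have odd_sk : odd (s ^ k) by rewrite -es' addn1 /= negbK in even_2e.
have odd_s : odd s by rewrite oddX in odd_sk; case/orP: odd_sk => // /eqP k00; rewrite k00 in k0.
have ok : odd k.
  apply: contraT => nk.
  have [j defk] : exists j, k = (j * 2)%N.
    by exists k./2; rewrite muln2 -{1}(odd_double_half k) (negbTE nk).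
  have [l defl] : exists l, (s ^ j = l * 2 + 1)%N.
    by exists (s ^ j)./2; rewrite muln2 -{1}(odd_double_half (s ^ j)) oddX odd_s orbT addnC.
  have : (4 %| s ^ k + 1)%N.
    rewrite es' (_ : 4 = 2 ^ 2)%N // dvdn_exp2l //.
  rewrite defk expnM defl => /dvdnP[r]; rewrite -mulnn; nia.
have [m] := exp_odd_mod_sqr s.+1%:Z ok.
have -> : s.+1%:Z - 1 = s%:Z by rewrite -addn1 PoszD addrK.
move=> H; have sk : (s ^ k)%N%:Z = s%:Z ^+ k.
  by elim: (k) => // r IHr; rewrite expnS PoszM exprS IHr.
have x_dvd : (s.+1 %| 2 ^ e)%N.
  rewrite -es'; have : (s.+1%:Z %| (s ^ k + 1)%N%:Z)%Z.
    apply/dvdzP; exists (k%:Z + m * s.+1%:Z).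
    by rewrite PoszD sk H; ring.
  by [].
have [i ie defx] : exists2 i, (i <= e)%N & s.+1 = (2 ^ i)%N by apply/dvdn_pfactor.
have [lt_ie|ge_ie] := ltnP i e; last first.
  have ei : i = e by apply/eqP; rewrite eqn_leq ie.
  have : (s ^ k = s ^ 1)%N by rewrite -es -ei -defx.
  by move/eqP; rewrite eqn_exp2l // => /eqP.
have : (2%:Z * s.+1%:Z %| (s ^ k + 1)%N%:Z)%Z.
  rewrite es' defx -PoszM -expnS; apply: dvdn_exp2l lt_ie.
case/dvdzP=> r; rewrite PoszD sk H => E.
have {}E : k%:Z + m * s.+1%:Z = r * 2%:Z.
  have x0 : s.+1%:Z != 0 by [].
  by apply: (mulIf x0); rewrite -mulrA -E; ring.
have [l defl] : exists l, s = (l * 2 + 1)%N.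
  by exists s./2; rewrite muln2 -{1}(odd_double_half s) odd_s addnC.
have [j defk] : exists j, k = (j * 2 + 1)%N.
  by exists k./2; rewrite muln2 -{1}(odd_double_half k) ok addnC.
move: E; rewrite defl defk; lia.
Qed.

Lemma prime_divisor_neq N s : (0 < N)%N -> prime s ->
  (exists t, [/\ prime t, t != s & t %| N]%N) \/ exists k, N = (s ^ k)%N.
Proof.
move=> N0 s_pr; have [/p_natP[k ->]|] := boolP (s.-nat N); first by right; exists k.
rewrite /pnat N0 /= => /allPn[t]; rewrite mem_primes => /and3P[t_pr _ tN] ts.
by left; exists t; split.
Qed.

Lemma composite_divisor m : (1 < m)%N -> ~~ prime m -> exists2 a, (1 < a < m)%N & (a %| m)%N.
Proof.
move=> m1 npm; exists (pdiv m); rewrite ?pdiv_dvd // prime_gt1 ?pdiv_prime //=.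
rewrite ltn_neqAle pdiv_leq ?(ltnW m1) // andbT.
by apply: contraNneq npm => <-; apply: pdiv_prime.
Qed.

End Arithmetic.

(** * Polynomials whose irreducible factors all have the same degree *)

Section Factorization.

Variable F : finFieldType.
Implicit Types (g h f : {poly F}).

Lemma irreducible_factor h : (1 < size h)%N -> exists2 g, irreducible_poly g & g %| h.
Proof.
have [s] := ubnP (size h); elim: s h => // s IHs h; rewrite ltnS => hs h1.
have [/irreducibleP irrh|/irreducibleP] := boolP (irreducibleb h); first by exists h.
case/(reducible_factor h1) => [h2 [h3 [defh /andP[s2 s2h] _]]].
have [g irrg gh] := IHs h2 (leq_trans s2h hs) s2.
by exists g; rewrite // defh dvdp_mulr.
Qed.

Lemma irreducible_size g : irreducible_poly g -> (0 < (size g).-1)%N.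
Proof. by case=> sg _; rewrite -ltnS prednK // ltnW. Qed.

Lemma divisor_of_degree h d : h != 0 ->
  (forall g, irreducible_poly g -> g %| h -> (size g).-1 = d) ->
  forall k, (k * d <= (size h).-1)%N -> exists2 f, f %| h & (size f).-1 = (k * d)%N.
Proof.
move=> h0 hd; elim=> [|k IHk] kd; first by exists 1; rewrite ?dvd1p // size_poly1.
have [d0|d0] := posnP d; first by exists 1; rewrite ?dvd1p // size_poly1 d0 muln0.
have [|f fh sf] := IHk; first by apply: leq_trans kd; rewrite leq_mul2r leqnSn orbT.
have := divpK fh; set r := h %/ f => defh.
have [r0 f0] : r != 0 /\ f != 0 by apply/norP; rewrite -mulf_eq0 defh.
have sh : ((size h).-1 = (size r).-1 + (size f).-1)%N.
  rewrite -defh size_mul //; move: r0 f0; rewrite -!size_poly_gt0.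
  by clear; move: (size r) (size f); lia.
have [|g irrg gr] := @irreducible_factor r.
  by move: kd d0; rewrite sh sf mulSn; clear; move: (k * d)%N (size r); lia.
have g0 := irredp_neq0 irrg; exists (g * f).
  by rewrite -defh dvdp_mul2r.
have gd : (size g).-1 = d by apply: hd; rewrite // -defh dvdp_mulr.
rewrite size_mul // mulSn -sf -gd; move: g0 f0; rewrite -!size_poly_gt0.
by clear; move: (size g) (size f); lia.
Qed.

(** Take a divisor [f] whose degree is the largest multiple of [d] available: a nonconstant cofactor
    would have an irreducible factor of degree [d], which is too large. *)
Lemma dvdn_size_irreducible h d : h != 0 ->
  (forall g, irreducible_poly g -> g %| h -> (size g).-1 = d) -> (d %| (size h).-1)%N.
Proof.
move=> h0 hd; have [f fh sf] := divisor_of_degree h0 hd (leq_trunc_div _ d).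
have := divpK fh; set r := h %/ f => defh.
have [r0 f0] : r != 0 /\ f != 0 by apply/norP; rewrite -mulf_eq0 defh.
have sh : ((size h).-1 = (size r).-1 + (size f).-1)%N.
  rewrite -defh size_mul //; move: r0 f0; rewrite -!size_poly_gt0.
  by clear; move: (size r) (size f); lia.
have [sr|sr] := leqP (size r) 1.
  rewrite sh sf; have -> : (size r).-1 = 0%N by move: sr; clear; case: (size r) => [|[]].
  by rewrite dvdn_mull.
have [g irrg gr] := irreducible_factor sr.
have gd : (size g).-1 = d by apply: hd; rewrite // -defh dvdp_mulr.
have d0 : (0 < d)%N by rewrite -gd irreducible_size.
have : ((size g).-1 <= (size r).-1)%N by rewrite -!subn1 leq_sub2r // dvdp_leq.
rewrite gd; have := ltn_ceil (size h).-1 d0.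
by rewrite mulSn -sf {1}sh ltn_add2r ltnNge => /negP.
Qed.

End Factorization.

(** * Factors of ['X^s - 1] over the field with two elements *)

Section Mersenne.

Variable F : finFieldType.
Hypothesis F2 : #|F| = 2%N.
Implicit Types (g h f : {poly F}).

Lemma pchar_card2 : 2%N \in [pchar F].
Proof.
have [p p_pr charFp] := finPcharP F.
have := dvdn_pchar_card charFp; rewrite F2 dvdn_prime2 // => /eqP p2.
by rewrite -p2.
Qed.

(** A root of [g] has order exactly [s] and lies outside [F], whose only unit is 1. *)
Lemma dvdn_irreducible_order s g : prime s -> irreducible_poly g -> g %| 'X^s - 1 ->
  coprimep g ('X - 1) -> (s %| (2 ^ (size g).-1).-1)%N /\ (1 < (size g).-1)%N.
Proof.
move=> s_pr irrg gs gX; have [L dimL [z root_z gen_z]] := irredp_FAdjoin irrg.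
have zs : z ^+ s = 1.
  move: gs; rewrite -(ev_eq0 irrg root_z) rmorphB rmorphXn rmorph1 /= fieldExt_hornerX subr_eq0.
  by move/eqP.
have z1 : z != 1.
  apply/eqP => z1; have : g %| 'X - 1.
    by rewrite -(ev_eq0 irrg root_z) rmorphB rmorph1 /= fieldExt_hornerX z1 subrr.
  by apply/negP; rewrite -irreducible_poly_coprime.
have z0 : z != 0.
  by apply/eqP => z0; have := oner_neq0 L; rewrite -zs z0 expr0n (gtn_eqF (prime_gt0 s_pr)) eqxx.
have q0 : (0 < 2 ^ (size g).-1)%N by rewrite expn_gt0.
have zm : z ^+ (2 ^ (size g).-1).-1 = 1.
  apply: (mulfI z0); rewrite mulr1 -exprS prednK // -F2.
  exact: expr_fieldExt.
split.
  apply: contraNT z1; rewrite -prime_coprime // => co; apply/eqP.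
  set m := _.-1 in zm co; pose w := chinese s m 1 0.
  rewrite -(expr1 z) -(expr_mod 1 zs) -(chinese_modl co 1 0) expr_mod // -/w.
  by rewrite -(expr_mod w zm) /w chinese_modr // mod0n.
rewrite ltn_neqAle irreducible_size // andbT; apply: contra z1 => /eqP d1.
have : z \in 1%VS.
  by rewrite in_alg_exp -[X in z ^+ X]expn1 [X in (_ ^ X)%N]d1 (expr_fieldExt dimL).
case/vlineP=> c zc; rewrite zc.
have c0 : c != 0 by apply: contraNneq z0 => c0; rewrite zc c0 scale0r.
by rewrite (card2_neq0 F2 c0) scale1r.
Qed.

(** Divisibility of the number of units of the residue field by [2 ^ d - 1] bounds the degree below
    by [d]; a root fixed by the [2 ^ d]-th power bounds it above. *)
Lemma mersenne_irreducible_degree d g : prime (2 ^ d).-1 -> irreducible_poly g ->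
  g %| 'X^((2 ^ d).-1) - 1 -> coprimep g ('X - 1) -> (size g).-1 = d.
Proof.
move=> s_pr irrg gs gX; have [sdvd d1] := dvdn_irreducible_order s_pr irrg gs gX.
have q0 e : (0 < 2 ^ e)%N by rewrite expn_gt0.
have d0 : (0 < d)%N by case: (d) s_pr.
have le_d : (d <= (size g).-1)%N.
  have pos : (0 < (2 ^ (size g).-1).-1)%N.
    by rewrite -ltnS prednK // -{1}(expn0 2) ltn_exp2l // ltnW.
  by have := dvdn_leq pos sdvd; rewrite -ltnS !prednK // leq_exp2l.
apply/eqP; rewrite eqn_leq le_d andbT leqNgt; apply/negP => lt_d.
have [L dimL [z root_z gen_z]] := irredp_FAdjoin irrg.
have zs : z ^+ (2 ^ d).-1 = 1.
  move: gs; rewrite -(ev_eq0 irrg root_z) rmorphB rmorphXn rmorph1 /= fieldExt_hornerX subr_eq0.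
  by move/eqP.
have := @gen_expr_neq _ _ pchar_card2 _ _ _ dimL gen_z d; rewrite d0 lt_d => /(_ isT).
by rewrite F2 -(prednK (q0 d)) exprS zs mulr1 eqxx.
Qed.

Lemma separable_mersenne d : (0 < d)%N -> separable_poly ('X^((2 ^ d).-1) - 1 : {poly F}).
Proof.
move=> d0; have := @separable_XnsubC F (2 ^ d).-1 1; rewrite polyC1; apply; rewrite ?oner_eq0 //.
apply: (natr_neq0_coprime pchar_card2).
by have := coprime_card_pred pchar_card2 d0; rewrite F2.
Qed.

End Mersenne.

(** * Linking every element of prime order to the hub *)

Section Connected.

Variables (F : finFieldType) (n p : nat) (T : 'M[F]_n.+1).
Hypotheses (charFp : p \in [pchar F]) (hubT : hub p T) (not_prime_n : ~~ prime n.+1).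
Implicit Types (X : 'M[F]_n.+1).

Let p_prime : prime p := pcharf_prime charFp.

(** If the minimal polynomial is irreducible, its composite degree [n.+1] provides an intermediate
    field; if it is reducible, a prime other than [s] dividing [q - 1] separates two factors. *)
Lemma linked_hub_gt2 X s : (2 < #|F|)%N -> (3 <= n)%N ->
  (prime #|F|.-1 -> (#|F| <= n.+1)%N) ->
  nsunit X -> prime s -> is_scalar_mx (X ^+ s) -> linked X T.
Proof.
move=> F3 n3 Fn nsX s_pr Xs; have [uX _] := andP nsX.
have [sp|sp] := eqVneq s p; first by apply: hubT; rewrite -?sp.
have cop : coprime s p by rewrite prime_coprime // dvdn_prime2.
have [//|sizeX] := linked_or_cyclic charFp hubT nsX Xs cop.
have minX1 : mxminpoly X = mxminpoly X * 1 by rewrite mulr1.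
have [/irreducibleP irrX|/irreducibleP redX] := boolP (irreducibleb (mxminpoly X)).
  have [L dimL [z root_z gen_z]] := irredp_FAdjoin irrX.
  have [|a aP advd] := composite_divisor _ not_prime_n; first by rewrite ltnS ltnW // ltnW.
  apply: (linked_subfield charFp hubT nsX Xs s_pr cop minX1 sizeX irrX dimL root_z gen_z (a := a)).
  - by rewrite sizeX.
  - by rewrite sizeX.
  - by rewrite size_poly1 eqxx.
have F1 : (1 < #|F|.-1)%N by rewrite -ltnS prednK // ltnW // ltnW.
have [[t [t_pr ts tF]]|[k Fk]] := prime_divisor_neq (ltnW F1) s_pr.
  by apply: (linked_reducible charFp hubT nsX Xs s_pr cop _ F1 t_pr ts tF redX); rewrite ltnW.
(* Now [q - 1] is a power of [s], and the degree [n.+1] is at most [s]. In characteristic 2 this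
   makes [s = q - 1], against [Fn]; in odd characteristic [s = 2], against [3 <= n]. *)
have [c c0 /andP[_]] := mxminpoly_factor_order uX Xs (prime_gt0 s_pr).
rewrite sizeX /= leqNgt => /negP[].
have [e Fe] := p_natP (card_pnat charFp).
have F0 : (0 < #|F|)%N by rewrite ltnW // ltnW.
have [p2|p_odd] := even_prime p_prime.
  have e1 : (1 < e)%N by case: (e) Fe F3 => [|[|]] // ->; rewrite p2.
  have k1 : k = 1%N by apply: mersenne_prime_power s_pr e1 _; rewrite -Fk Fe p2.
  have Fs : #|F|.-1 = s by rewrite Fk k1 expn1.
  by have := Fn; rewrite Fs => /(_ s_pr); rewrite -(prednK F0) Fs.
have s2 : s = 2%N.
  have e0 : (0 < k)%N by rewrite lt0n; apply: contraTneq F1 => k0; rewrite Fk k0.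
  have : (2 %| s ^ k)%N by rewrite -Fk dvdn2 -[odd _]negbK -oddS prednK // Fe oddX p_odd orbT.
  by rewrite Euclid_dvdX // dvdn_prime2 // => /andP[/eqP].
by rewrite s2 ltnW.
Qed.

(** A factor of composite degree [d] gives a subfield element, and a prime other than [s] dividing
    [2 ^ d - 1] gives an element of that order. In the latter case the cofactor has degree at least
    2, since neither [n.+1] nor [n] is prime. *)
Lemma linked_hub_card2 X s : #|F| = 2%N -> (8 <= n)%N -> ~~ prime n ->
  (forall d, prime d -> prime (2 ^ d).-1 -> (d %| n.+1)%N -> ((2 ^ d).-1 <= n.+1)%N) ->
  (forall d, prime d -> prime (2 ^ d).-1 -> (d %| n)%N -> ((2 ^ d).-1 <= n)%N) ->
  nsunit X -> prime s -> is_scalar_mx (X ^+ s) -> linked X T.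
Proof.
move=> F2 n8 npn case2 case3 nsX s_pr Xs; have [uX _] := andP nsX.
have [sp|sp] := eqVneq s p; first by apply: hubT; rewrite -?sp.
have cop : coprime s p by rewrite prime_coprime // dvdn_prime2.
have [//|sizeX] := linked_or_cyclic charFp hubT nsX Xs cop.
have sepX := mxminpoly_separable charFp uX Xs cop.
have [c c0 /andP[fX _]] := mxminpoly_factor_order uX Xs (prime_gt0 s_pr).
rewrite (card2_neq0 F2 c0) polyC1 in fX.
set f := mxminpoly X in sizeX sepX fX.
have f0 : f != 0 by rewrite separable_poly_neq0.
pose l : {poly F} := 'X - 1; have sl : size l = 2%N by rewrite /l -polyC1 size_XsubC.
have l0 : l != 0 by rewrite -size_poly_gt0 sl.
have irrl : irreducible_poly l by rewrite /l -polyC1; apply: irredp_XsubC.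
(* [f'] is [f] without the factor [l], whose presence is recorded by [eps]. *)
have [f' [eps [f'f cop_l size_f']]] : exists f' (eps : bool),
    [/\ f' %| f, coprimep f' l & n.+1 = ((size f').-1 + eps)%N].
  have [lf|lf] := boolP (l %| f); last first.
    by exists f, false; rewrite coprimep_sym irreducible_poly_coprime // lf sizeX addn0.
  exists (f %/ l), true; have := divpK lf; set f' := f %/ l => deff; split.
  - by rewrite -deff dvdp_mulr.
  - by apply: separable_coprime sepX _; rewrite deff.
  have f'0 : f' != 0 by apply: contraNneq f0 => f'0; rewrite -deff f'0 mul0r.
  move: sizeX; rewrite -deff size_mul // sl; rewrite -size_poly_gt0 in f'0.
  by move: f'0; clear; move: (size f'); lia.
have f'0 : f' != 0 by apply: contraNneq f0 => f'0; rewrite -dvd0p -f'0.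
have [|g irrg gf'] := @irreducible_factor F f'.
  by move: n8; rewrite -ltnS size_f'; clear; case: eps; move: (size f'); lia.
have gf := dvdp_trans gf' f'f.
have gl : coprimep g l by apply: coprimep_dvdr gf' cop_l.
have gs : g %| 'X^s - 1 by apply: dvdp_trans gf fX.
have [sd d1] := dvdn_irreducible_order F2 s_pr irrg gs gl.
have [L dimL [z root_z gen_z]] := irredp_FAdjoin irrg.
have minX : mxminpoly X = g * (f %/ g) by rewrite mulrC divpK.
have sh := size_minX_factors minX sizeX.
set d := (size g).-1 in sh sd d1.
have [d_pr|d_npr] := boolP (prime d); last first.
  have [a aP advd] := composite_divisor d1 d_npr.
  apply: (linked_subfield charFp hubT nsX Xs s_pr cop minX sizeX irrg dimL root_z gen_z aP advd).
  by rewrite F2 eqxx orbT.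
have qd0 : (0 < (2 ^ d).-1)%N.
  have := prime_gt1 d_pr; case: (d) => [|[|r]] // _.
  by rewrite -ltnS prednK ?expn_gt0 // -{1}(expn0 2) ltn_exp2l.
have [[t [t_pr ts td]]|[k dk]] := prime_divisor_neq qd0 s_pr.
  apply: (linked_prime_order charFp hubT nsX Xs s_pr cop minX sizeX irrg dimL root_z gen_z F2 t_pr ts).
    by rewrite F2.
  have dn : d != n.+1 by apply: contraNneq not_prime_n => <-.
  have dn' : d != n by apply: contraNneq npn => <-.
  by move: sh dn dn'; rewrite -/d; clear; move: d (size _).-1; lia.
(* What remains is a Mersenne prime [s]: all irreducible factors of [f'] have degree [d], so [d]
   divides the degree of [f'], which is less than [s]; [case2] or [case3] excludes this. *)
have s_eq : (2 ^ d).-1 = s by rewrite dk (mersenne_prime_power s_pr (prime_gt1 d_pr) dk) expn1.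
have dvd_d : (d %| (size f').-1)%N.
  apply: dvdn_size_irreducible f'0 _ => g' irrg' g'f'.
  apply: (mersenne_irreducible_degree F2); rewrite ?s_eq //.
    by apply: dvdp_trans (dvdp_trans g'f' f'f) fX.
  exact: coprimep_dvdr g'f' cop_l.
have lt_f' : ((size f').-1 < s)%N.
  have : f' * l %| 'X^s - 1.
    rewrite Gauss_dvdp // (dvdp_trans f'f fX) /l.
    by rewrite -[X in 'X^s - X](expr1n _ s) subrXX; apply: dvdp_mulr.
  move/dvdp_leq; rewrite size_XnsubC ?prime_gt0 // size_mul // sl.
  have Xs0 : 'X^s - 1 != 0 :> {poly F}.
    by rewrite -size_poly_gt0 size_XnsubC // prime_gt0.
  move=> /(_ Xs0); rewrite -size_poly_gt0 in f'0; move: f'0; clear.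
  by move: (size f'); lia.
case: eps size_f' => size_f'.
  rewrite addn1 in size_f'; case: size_f' => size_f'.
  have dn : (d %| n)%N by rewrite size_f'.
  have := case3 d d_pr; rewrite s_eq => /(_ s_pr dn); rewrite leqNgt => /negP[].
  by rewrite size_f'.
rewrite addn0 in size_f'; have dn : (d %| n.+1)%N by rewrite size_f'.
have := case2 d d_pr; rewrite s_eq => /(_ s_pr dn); rewrite leqNgt => /negP[].
by rewrite size_f'.
Qed.

End Connected.

(** * Disconnected cases *)

Section Disconnected.

Variables (F : finFieldType) (n : nat).
Implicit Types (X B C : 'M[F]_n.+1) (f g : {poly F}).

(* In PGL, an element with a nontrivial power in the group generated by [X], which has prime
   order [r], centralizes [X], hence has order [r] itself and lies in that group. *)
Lemma disconnected_of_exponent X r : prime r -> nsunit X ->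
  (forall B, B \in unitmx -> B * X = X * B -> is_scalar_mx (B ^+ r)) ->
  ~ connected_reduced_power_graph (PGL n.+1 F).
Proof.
move=> r_pr nsX expX; have [uX _] := andP nsX; have [B nsB XB] := nsunit_noncomm nsX.
pose S C := to_PGL X \in <[to_PGL C]>%g.
have Scomm C : C \in unitmx -> S C -> C * X = X * C.
  move=> uC /cycleP[k]; rewrite -to_PGLX // => /eqP.
  rewrite eq_sym => /(to_PGL_eq (unitmx_exp k uC) uX)[a _ ->].
  by rewrite -scalerAl -scalerAr -exprS -exprSr.
apply: (@disconnected_of_closed _ _ S X B) => //.
- exact: cycle_id.
- by apply/negP => SB; have [uB _] := andP nsB; case: XB; rewrite (Scomm B).
- move=> a C a0; rewrite /S; have [uC|nuC] := boolP (C \in unitmx).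
    have uaC : a *: C \in unitmx by rewrite unitmxZ ?unitfE.
    suff -> : to_PGL (a *: C) = to_PGL C by [].
    by apply/esym/eqP/to_PGL_eq => //; exists a.
  (* Both matrices are singular and receive the same default value. *)
  have -> : to_PGL C = to_PGL (a *: C) => //.
  rewrite /to_PGL /to_GL /insubd !insubN //; by rewrite unitmxZ ?unitfE.
move=> C k /andP[uC nsC] /andP[uCk nsCk]; rewrite /S to_PGLX //.
apply/idP/idP => [SC|]; last by apply: (subsetP (cycleX _ _)).
have ck1 : (to_PGL C ^+ k != 1)%g by rewrite -to_PGLX // to_PGL_eq1.
have oC : #[to_PGL C]%g = r.
  apply/(prime_nt_dvdP r_pr); first by rewrite order_eq1 to_PGL_eq1.
  by rewrite order_dvdn -to_PGLX // to_PGL_eq1 ?unitmx_exp // expX // Scomm.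
have /eqP <- // : generator <[to_PGL C]>%g (to_PGL C ^+ k)%g.
by rewrite generator_coprime oC prime_coprime // -oC order_dvdn.
Qed.

(** The vertices commuting with [X] form a union of components: [C] commutes with [C ^+ k], so if
    the latter commutes with [X] the hypothesis passes this on to [C]. *)
Lemma disconnected_of_centralizer X : nsunit X ->
  (forall B C, nsunit B -> B * X = X * B -> C * B = B * C -> C * X = X * C) ->
  ~ connected_reduced_power_graph (PGL n.+1 F).
Proof.
move=> nsX centX; have [uX _] := andP nsX; have [B nsB XB] := nsunit_noncomm nsX.
apply: (@disconnected_of_closed _ _ (fun C => C * X == X * C) X B) => //.
- by apply/eqP => BX; case: XB.
- by move=> a C _ /eqP CX; rewrite -scalerAl -scalerAr CX.
move=> C k nsC nsCk; apply/eqP/eqP => [CX|CkX]; first exact/esym/commrX/esym.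
by apply: (centX _ _ nsCk CkX); rewrite -exprS exprSr.
Qed.

(** [X] is multiplication by [T] on [F[T]/(f)] in the basis of powers of [T]. The vector [v] of 1 is
    cyclic, so a matrix commuting with [X] is determined by the image of [v]. *)
Lemma ex_companion f : size f = n.+2 -> exists X,
  (forall q, horner_mx X q = 0 <-> f %| q) /\
  (forall B, B * X = X * B -> exists q, B = horner_mx X q).
Proof.
move=> sf; have f0 : f != 0 by rewrite -size_poly_gt0 sf.
pose r q : 'rV[F]_n.+1 := poly_rV (q %% f).
pose X : 'M[F]_n.+1 := \matrix_(i < n.+1) r 'X^(i.+1).
have rD q1 q2 : r (q1 + q2) = r q1 + r q2 by rewrite /r modpD raddfD.
have rZ c q : r (c *: q) = c *: r q by rewrite /r modpZl linearZ.
have sizer (q : {poly F}) : (size (q %% f)%R <= n.+1)%N by rewrite -ltnS -sf ltn_modp.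
have r_sum (I : finType) (c : I -> F) (t : I -> {poly F}) :
    r (\sum_i c i *: t i) = \sum_i c i *: r (t i).
  by rewrite /r (big_morph (fun q => q %% f) (modpD f) (mod0p f)) linear_sum;
     apply: eq_bigr => i _; rewrite modpZl linearZ.
have rX (q : {poly F}) : r q *m X = r (q * 'X).
  transitivity (r ((q %% f) * 'X)); last by rewrite /r mulrC modp_mul mulrC.
  rewrite mulmx_sum_row -[in RHS](take_poly_id (sizer q)) /take_poly poly_def mulr_suml.
  under [in RHS]eq_bigr do rewrite -scalerAl -exprSr.
  rewrite r_sum; apply: eq_bigr => i _; by rewrite rowK mxE.
pose v := r 1.
have rE (q : {poly F}) : v *m horner_mx X q = r q.
  elim/poly_ind: q => [|q c IHq]; first by rewrite rmorph0 mulmx0 /r mod0p raddf0.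
  rewrite rmorphD rmorphM /= horner_mx_X horner_mx_C mulmxDr -mulmxE mulmxA IHq rX.
  by rewrite mul_mx_scalar rD -rZ alg_polyC.
have span (u : 'rV[F]_n.+1) : u = v *m horner_mx X (rVpoly u).
  by rewrite rE /r modp_small ?rVpolyK // sf ltnS size_poly.
have hom0 A : (forall u : 'rV[F]_n.+1, u *m A = 0) -> A = 0 :> 'M[F]_n.+1.
  by move=> uA; apply/row_matrixP => i; rewrite rowE uA raddf0.
exists X; split=> [q|B BX].
  split=> [hq|fq].
    have : r q = 0 by rewrite -rE hq mulmx0.
    by move/(congr1 rVpoly); rewrite poly_rV_K // raddf0 => /eqP.
  apply: hom0 => u; rewrite [u]span -mulmxA mulmxE -rmorphM rE /r.
  by have /modp_eq0P -> : f %| rVpoly u * q; rewrite ?raddf0 ?dvdp_mull.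
exists (rVpoly (v *m B)); apply/eqP; rewrite -subr_eq0; apply/eqP/hom0 => u.
have cB : horner_mx X (rVpoly u) *m B = B *m horner_mx X (rVpoly u).
  exact/comm_horner_mx/esym.
have cQ q : horner_mx X q *m horner_mx X (rVpoly u) = horner_mx X (rVpoly u) *m horner_mx X q.
  exact: comm_horner_mx2.
rewrite mulmxBr {1}[u]span -mulmxA cB mulmxA {1}[v *m B]span.
by rewrite -(mulmxA v) cQ mulmxA -(span u) subrr.
Qed.

Lemma nsunit_companion f X m : (0 < n)%N -> size f = n.+2 ->
  (forall q, horner_mx X q = 0 <-> f %| q) -> (0 < m)%N -> f %| 'X^m - 1 -> X ^+ m = 1 /\ nsunit X.
Proof.
move=> n0 sf hX m0 fm.
have Xm : X ^+ m = 1.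
  move/hX: fm; rewrite rmorphB rmorphXn rmorph1 /= horner_mx_X => /eqP.
  by rewrite subr_eq0 => /eqP.
split=> //; rewrite /nsunit (unit_of_exp m0 Xm); apply/is_scalar_mxP => [[a Xa]].
have : f %| 'X - a%:P by apply/hX; rewrite rmorphB /= horner_mx_X horner_mx_C Xa subrr.
move/dvdp_leq; rewrite polyXsubC_eq0 => /(_ isT); rewrite size_XsubC sf.
by rewrite !ltnS leqNgt n0.
Qed.

(** For [f = ('X - 1) ^+ n.+1], which divides ['X^p - 1], Frobenius makes the [p]-th power of every
    polynomial in [X] scalar. *)
Lemma disconnected_unipotent p : p \in [pchar F] -> (0 < n < p)%N ->
  ~ connected_reduced_power_graph (PGL n.+1 F).
Proof.
move=> charFp /andP[n0 np]; have p_pr := pcharf_prime charFp.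
have charP : p \in [pchar {poly F}] by rewrite pchar_poly.
pose f : {poly F} := ('X - 1) ^+ n.+1.
have sf : size f = n.+2 by rewrite /f -polyC1 size_exp_XsubC.
have fp : f %| 'X^p - 1.
  have -> : 'X^p - 1 = ('X - 1) ^+ p :> {poly F}.
    by rewrite -!(pFrobenius_autE charP) rmorphB rmorph1.
  by rewrite /f; apply: dvdp_exp2l.
have [X [hX centX]] := ex_companion sf.
have [Xp nsX] := nsunit_companion n0 sf hX (prime_gt0 p_pr) fp.
apply: (disconnected_of_exponent p_pr nsX) => B _ /centX[q ->].
elim/poly_ind: q => [|q c /is_scalar_mxP[a IHq]].
  by rewrite rmorph0 expr0n (gtn_eqF (prime_gt0 p_pr)) mx0_is_scalar.
apply/is_scalar_mxP; exists (a + c ^+ p).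
rewrite -rmorphXn -(pFrobenius_autE charP) rmorphD rmorphM /= !pFrobenius_autE.
rewrite rmorphD rmorphM !rmorphXn /= horner_mx_X Xp mulr1 IHq raddfD /=; congr (_ + _).
by rewrite horner_mx_C -(rmorphXn (@scalar_mx F n.+1)).
Qed.

(** With [Q = #|F| ^ j], [X ^+ Q = X] forces [B ^+ Q = B] for every polynomial [B] in [X], so units
    have order dividing the prime [Q - 1]. *)
Lemma disconnected_split f j : (0 < n)%N -> (0 < j)%N -> size f = n.+2 ->
  f %| 'X^((#|F| ^ j).-1) - 1 -> prime (#|F| ^ j).-1 ->
  ~ connected_reduced_power_graph (PGL n.+1 F).
Proof.
move=> n0 j0 sf fj j_pr; have [p _ charFp] := finPcharP F.
have [X [hX centX]] := ex_companion sf.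
have [Xr nsX] := nsunit_companion n0 sf hX (prime_gt0 j_pr) fj.
have q0 : (0 < #|F| ^ j)%N by rewrite expn_gt0 ltnW // finNzRing_gt1.
apply: (disconnected_of_exponent j_pr nsX) => B uB /centX[q defB].
have fixX : horner_mx X 'X ^+ (#|F| ^ j) = horner_mx X 'X.
  by rewrite /= horner_mx_X -(prednK q0) exprS Xr mulr1.
have /= fixB := frobenius_fixed charFp fixX q; rewrite -defB in fixB.
suff -> : B ^+ (#|F| ^ j).-1 = 1 by apply: scalar_mx_is_scalar.
by apply: (mulrI uB); rewrite mulr1 -exprS prednK.
Qed.

(** ['X^(q - 1) - 1] is a product of linear factors, and [f] is a product of [n.+1] of them. *)
Lemma disconnected_linear_factors : (0 < n)%N -> prime #|F|.-1 -> (n.+1 < #|F|)%N ->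
  ~ connected_reduced_power_graph (PGL n.+1 F).
Proof.
move=> n0 q_pr nq; have q1 := finNzRing_gt1 F.
have P0 : 'X^(#|F|.-1) - 1 != 0 :> {poly F} by rewrite -size_poly_gt0 size_XnsubC // prime_gt0.
have deg1 g : irreducible_poly g -> g %| 'X^(#|F|.-1) - 1 -> (size g).-1 = 1%N.
  move=> irrg gX; have [L dimL [z root_z gen_z]] := irredp_FAdjoin irrg.
  have zq : z ^+ #|F|.-1 = 1.
    move: gX; rewrite -(ev_eq0 irrg root_z) rmorphB rmorphXn rmorph1 /= fieldExt_hornerX subr_eq0.
    by move/eqP.
  have /Fadjoin_idP : z \in 1%AS by rewrite in_alg_exp -(prednK (ltnW q1)) exprS zq mulr1.
  by rewrite gen_z -dimL => ->; rewrite dimv1.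
have [|f fX sf] := divisor_of_degree P0 deg1 (k := n.+1).
  by rewrite muln1 size_XnsubC ?prime_gt0 //= -ltnS prednK // ltnW.
rewrite muln1 in sf; have sf' : size f = n.+2 by case: (size f) sf => //= m ->.
by apply: (@disconnected_split f 1) sf' _ _; rewrite ?expn1.
Qed.

(** [f] is a product of irreducible factors, all of degree [d], of [('X^s - 1) / ('X - 1)], times
    ['X - 1] when [eps] holds. The strict bound ensures that there are enough of them. *)
Lemma disconnected_mersenne d (eps : bool) : #|F| = 2%N -> (0 < n)%N -> prime d ->
  prime (2 ^ d).-1 -> (d %| n.+1 - eps)%N -> (n.+1 - eps < (2 ^ d).-1)%N ->
  ~ connected_reduced_power_graph (PGL n.+1 F).
Proof.
move=> F2 n0 d_pr s_pr /dvdnP[k nk] n_lt; set s := (2 ^ d).-1 in s_pr n_lt.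
have s0 := prime_gt0 s_pr; have d0 := prime_gt0 d_pr.
pose l : {poly F} := 'X - 1; have sl : size l = 2%N by rewrite /l -polyC1 size_XsubC.
have ls : l %| 'X^s - 1.
  by rewrite -[X in 'X^s - X](expr1n _ s) subrXX; apply: dvdp_mulr.
have Xs0 : 'X^s - 1 != 0 :> {poly F} by rewrite -size_poly_gt0 size_XnsubC.
have := divpK ls; set h := _ %/ l => defh.
have h0 : h != 0 by apply: contraNneq Xs0 => h0; rewrite -defh h0 mul0r.
have l0 : l != 0 by rewrite -size_poly_gt0 sl.
have sh : (size h).-1 = s.-1.
  have := congr1 (fun q : {poly F} => size q) defh; rewrite /= size_XnsubC //.
  rewrite size_mul // sl; move: h0; rewrite -size_poly_gt0; clear.
  by move: (size h); lia.
have cop : coprimep h l.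
  by apply: (separable_coprime (separable_mersenne F2 d0)); rewrite -/s defh.
have hd g : irreducible_poly g -> g %| h -> (size g).-1 = d.
  move=> irrg gh; apply: (mersenne_irreducible_degree F2) => //.
    by apply: dvdp_trans gh _; rewrite -/s -defh dvdp_mulr.
  exact: coprimep_dvdr gh cop.
have [|f fh sf] := divisor_of_degree h0 hd (k := k).
  by rewrite -nk sh -ltnS prednK.
have f0 : f != 0 by apply: contraNneq h0 => f0; rewrite -dvd0p -f0.
have size_f : size (f * l ^+ eps) = n.+2.
  move: sf; rewrite -nk; rewrite -size_poly_gt0 in f0; clear -f0 sl l0 n0.
  case: eps => /= sf; last by rewrite mulr1; case: (size f) f0 sf => // m _ /= ->.
  have {}sf : (size f).-1 = n by rewrite sf subn1.
  rewrite expr1 size_mul -?size_poly_gt0 ?sl //.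
  by case: (size f) f0 sf => // m _ /= ->; rewrite addn2.
apply: (disconnected_split n0 d0 size_f); rewrite F2 // -/s -defh.
by apply: dvdp_mul => //; case: (eps); rewrite ?expr0 ?dvd1p ?expr1 ?dvdpp.
Qed.

(** A root of [('X^(q^m - 1) - 1) / ('X^(q - 1) - 1)] is fixed by the [q^m]-th power but not by the
    [q]-th; its degree divides the prime [m] and is not 1. *)
Lemma ex_irreducible m : prime m -> exists2 g : {poly F}, irreducible_poly g & (size g).-1 = m.
Proof.
move=> m_pr; have [p _ charFp] := finPcharP F.
have m0 := prime_gt0 m_pr; have q1 := finNzRing_gt1 F.
have qe0 e : (0 < #|F| ^ e)%N by rewrite expn_gt0 ltnW.
have lt_qm : (#|F|.-1 < (#|F| ^ m).-1)%N.
  by rewrite -ltnS !prednK ?(ltnW q1) // -{1}(expn1 #|F|) ltn_exp2l // prime_gt1.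
have qm0 : (0 < (#|F| ^ m).-1)%N by apply: leq_ltn_trans lt_qm.
have q'0 : (0 < #|F|.-1)%N by rewrite -ltnS prednK // ltnW.
pose h : {poly F} := 'X^((#|F| ^ m).-1) - 1; pose h1 : {poly F} := 'X^(#|F|.-1) - 1.
have seph : separable_poly h.
  have := @separable_XnsubC F (#|F| ^ m).-1 1; rewrite polyC1; apply; rewrite ?oner_eq0 //.
  exact: (natr_neq0_coprime charFp (coprime_card_pred charFp m0)).
have h1h : h1 %| h.
  rewrite /h; have /dvdnP[k ->] : (#|F|.-1 %| (#|F| ^ m).-1)%N.
    by rewrite -!subn1 -{2}(exp1n m) subn_exp dvdn_mulr.
  by rewrite mulnC exprM -[X in _ - X](expr1n _ k) subrXX dvdp_mulr.
have := divpK h1h; set r := h %/ h1 => defh.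
have sh1 : size h1 = #|F|.-1.+1 by rewrite size_XnsubC.
have h0 := separable_poly_neq0 seph.
have [r0 h10] : r != 0 /\ h1 != 0 by apply/norP; rewrite -mulf_eq0 defh.
have sr : (1 < size r)%N.
  have : size h = (#|F| ^ m).-1.+1 by rewrite size_XnsubC.
  rewrite -defh size_mul // sh1; move: lt_qm; clear; move: (size r) (_ ^ m)%N (#|F|.-1).
  by lia.
have [g irrg gr] := irreducible_factor sr; exists g => //.
have cop : coprimep g h1.
  by apply: coprimep_dvdr gr _; apply: separable_coprime seph _; rewrite defh.
have [L dimL [z root_z gen_z]] := irredp_FAdjoin irrg.
have evX e : (g %| 'X^e - 1) = (z ^+ e == 1).
  by rewrite -(ev_eq0 irrg root_z) rmorphB rmorphXn rmorph1 /= fieldExt_hornerX subr_eq0.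
have /eqP zm1 : z ^+ (#|F| ^ m).-1 == 1.
  by rewrite -evX; apply: dvdp_trans gr _; rewrite -/h -defh dvdp_mulr.
have zm : z ^+ (#|F| ^ m) = z.
  by rewrite -(prednK (qe0 m)) exprS zm1 mulr1.
have z0 : z != 0.
  by apply/eqP => z0; have := oner_neq0 L; rewrite -zm1 z0 expr0n (gtn_eqF qm0) eqxx.
have nz : z ^+ #|F| != z.
  rewrite -(prednK (ltnW q1)) exprS -[X in _ != X]mulr1 (inj_eq (mulfI z0)) -evX -/h1.
  by rewrite -irreducible_poly_coprime.
have d0 := irreducible_size irrg; set d := (size g).-1 in d0 dimL *.
have d1 : d != 1%N.
  by apply: contraNneq nz => d1; have := expr_fieldExt dimL z; rewrite -/d d1 expn1 => ->.
have ze k e : z ^+ (#|F| ^ (d * k + e)) = z ^+ (#|F| ^ e).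
  rewrite expnD exprM; congr (_ ^+ _); elim: k => [|k IHk]; first by rewrite muln0 expr1.
  by rewrite mulnS expnD exprM (expr_fieldExt dimL).
(* The root is fixed by the [q ^ (m %% d)]-th power, which is impossible for a generator unless the
   remainder is 0. *)
have : (m %% d == 0)%N.
  apply: contraT; rewrite -lt0n => r_gt0.
  have := @gen_expr_neq _ _ charFp _ _ _ dimL gen_z (m %% d)%N; rewrite r_gt0 ltn_mod d0 => /(_ isT).
  by rewrite -(ze (m %/ d)%N) mulnC -divn_eq zm eqxx.
by move=> /(prime_nt_dvdP m_pr d1).
Qed.

(* [eps] selects between an irreducible polynomial of degree [n.+1] and one of degree [n]
   multiplied by ['X - 1]. *)
Lemma disconnected_prime_degree (eps : bool) : (0 < n)%N -> prime (n.+1 - eps)%N ->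
  (eps -> #|F| = 2%N) -> ~ connected_reduced_power_graph (PGL n.+1 F).
Proof.
move=> n0 m_pr F2; have [g irrg sg] := ex_irreducible m_pr.
set m := (n.+1 - eps)%N in m_pr sg.
have g0 := irredp_neq0 irrg; have m1 := prime_gt1 m_pr; have q1 := finNzRing_gt1 F.
pose l : {poly F} := if eps then 'X - 1 else 1.
have l0 : l != 0 by rewrite /l; case: (eps); rewrite ?oner_eq0 // -polyC1 polyXsubC_eq0.
have sl : size l = eps.+1 by rewrite /l; case: (eps); rewrite ?size_poly1 // -polyC1 size_XsubC.
have sg' : size g = m.+1 by rewrite -sg prednK // size_poly_gt0.
have cop : coprimep g l.
  rewrite irreducible_poly_coprime //; apply/negP => /dvdp_leq; rewrite l0 sl sg' => /(_ isT).
  by rewrite ltnS leqNgt (leq_ltn_trans _ m1) // leq_b1.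
pose f := g * l.
have sf : size f = n.+2.
  rewrite size_mul // sg' sl /m; clear -n0; case: eps => /=; last by rewrite subn0 addn1.
  by rewrite subn1 addn2.
have dvd_f v : g %| v -> l %| v -> f %| v by move=> gv lv; rewrite Gauss_dvdp ?gv.
have [L dimL [z root_z gen_z]] := irredp_FAdjoin irrg; rewrite sg in dimL.
have evg v := ev_eq0 irrg root_z v.
have z0 : z != 0.
  apply/eqP => z0; have : g %| 'X by rewrite -evg /= fieldExt_hornerX z0.
  by move/dvdp_leq; rewrite polyX_eq0 size_polyX sg' => /(_ isT); rewrite ltnS leqNgt m1.
have qm : (0 < (#|F| ^ m).-1)%N.
  by rewrite -ltnS prednK ?expn_gt0 ?(ltnW q1) // -{1}(expn0 #|F|) ltn_exp2l // ltnW.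
have [X [hX centX]] := ex_companion sf.
have [|Xm nsX] := nsunit_companion n0 sf hX qm.
  apply: dvd_f.
    rewrite -evg rmorphB rmorphXn rmorph1 /= fieldExt_hornerX subr_eq0.
    rewrite -(inj_eq (mulfI z0)) mulr1 -exprS prednK ?expn_gt0 ?(ltnW q1) //.
    have dimL' : \dim {:L} = (size g).-1 by rewrite sg.
    by rewrite -sg (expr_fieldExt dimL').
  rewrite /l; case: (eps); rewrite ?dvd1p //.
  by rewrite -[X in 'X^ _ - X](expr1n _ (#|F| ^ m).-1) subrXX dvdp_mulr.
apply: (disconnected_of_centralizer nsX) => B C nsB BX CB.
have [r defB] := centX B BX; have [uB nscB] := andP nsB.
have cancelB (v : {poly F}) : f %| r * v -> f %| v.
  move/hX; rewrite rmorphM /= -defB => e; apply/hX.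
  by rewrite -(mulKr uB (horner_mx X v)) e mulr0.
have not_dvd (v : {poly F}) : v != 0 -> (size v <= n.+1)%N -> ~~ (f %| v).
  by move=> v0 sv; apply/negP => /dvdp_leq; rewrite v0 sf leqNgt ltnS sv => /(_ isT).
(* [B] is a unit, so [r] cannot vanish at 1; over the field with two elements its value there is
   1. *)
have r1 : eps -> r.[1] = 1.
  move=> e; apply: (card2_neq0 (F2 e)); apply/negP => r1.
  have lr : l %| r by rewrite /l e -polyC1 dvdp_XsubCl.
  have /cancelB : f %| r * g by rewrite /f mulrC dvdp_mul2r.
  by apply/negP; apply: not_dvd; rewrite // sg' /m e subn1.
pose b := fieldExt_horner z r.
have b1 : b \notin 1%VS.
  apply/negP => /vlineP[c bc]; case/negP: nscB.
  have gr : g %| r - c%:P.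
    by rewrite -evg rmorphB /= fieldExt_hornerC -/b bc subrr.
  have lr : l %| r - c%:P.
    rewrite /l; case: (boolP eps) => e; last exact: dvd1p.
    have c0 : c != 0.
      apply/eqP => c0; rewrite c0 polyC0 subr0 in gr.
      have /cancelB : f %| r * l by rewrite /f dvdp_mul2r.
      by apply/negP; apply: not_dvd; rewrite // sl e.
    rewrite (card2_neq0 (F2 e) c0) -polyC1 dvdp_XsubCl rootE !hornerE r1 // subrr.
    by [].
  have /hX := dvd_f _ gr lr; rewrite rmorphB /= -defB horner_mx_C => /eqP.
  by rewrite subr_eq0 => /eqP ->; apply: scalar_mx_is_scalar.
(* The degree [m] is prime, so no field lies strictly between [F] and [L]. *)
have gen_b : <<1; b>>%VS = fullv.
  apply/eqP; rewrite -(dimv_leqif_eq (subvf _)) eqn_leq dimvS ?subvf //= dimL.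
  have : (\dim <<1; b>> %| m)%N by rewrite -dimL; apply: field_dimS; apply: subvf.
  move/(prime_nt_dvdP m_pr) => -> //.
  apply: contra b1 => /eqP db; rewrite -adjoin_deg_eq1 adjoin_degreeE.
  by rewrite dimv1 divn1 db.
have /Fadjoin1_polyP[s0 zs0] : z \in <<1; b>>%VS by rewrite gen_b memvf.
have comp_ev (v : {poly F}) : fieldExt_horner b v = fieldExt_horner z (v \Po r).
  by apply: rmorph_comp_poly => [|c]; rewrite /= ?fieldExt_hornerX ?fieldExt_hornerC.
have comp_h (v : {poly F}) : horner_mx B v = horner_mx X (v \Po r).
  by apply: rmorph_comp_poly => [|c]; rewrite /= ?horner_mx_X ?horner_mx_C -?defB.
(* It is enough to express [X] as a polynomial in [B]: whatever commutes with [B] then commutes with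
   [X]. *)
suff [s gs ls] : exists2 s, fieldExt_horner b s = z & (eps -> s.[1] = 1).
  have XB : X = horner_mx B s.
    have /hX : f %| (s \Po r) - 'X.
      apply: dvd_f.
        by rewrite -evg rmorphB /= -comp_ev gs fieldExt_hornerX subrr.
      rewrite /l; case: (boolP eps) => e; last exact: dvd1p.
      by rewrite -polyC1 dvdp_XsubCl rootE !hornerE horner_comp r1 // ls // subrr.
    by rewrite rmorphB /= -comp_h horner_mx_X => /eqP; rewrite subr_eq0 => /eqP.
  by rewrite XB; apply: (comm_mx_horner s (CB : comm_mx C B)).
have [e|ne] := boolP eps; last by exists s0.
(* [S] vanishes at [b] and, having an odd number of terms, is 1 at 1; a multiple of it corrects the
   value of [s0] at 1 without changing the one at [b]. *)
pose S : {poly F} := \sum_(i < (#|F| ^ m).-1) 'X^i.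
have bS : fieldExt_horner b S = 0.
  have bb : b - 1 != 0 by rewrite subr_eq0; apply: contraNneq b1 => ->; apply: mem1v.
  have b0 : b != 0 by apply: contraNneq b1 => ->; rewrite mem0v.
  apply: (mulfI bb); rewrite mulr0 rmorph_sum /=.
  under eq_bigr do rewrite rmorphXn /= fieldExt_hornerX.
  rewrite -subrX1; apply/eqP; rewrite subr_eq0 -(inj_eq (mulfI b0)) mulr1 -exprS prednK ?expn_gt0 ?(ltnW q1) //.
  have dimL' : \dim {:L} = (size g).-1 by rewrite sg.
  by rewrite -sg (expr_fieldExt dimL').
have S1 : S.[1] = 1.
  rewrite horner_sum; under eq_bigr do rewrite hornerXn expr1n.
  rewrite sumr_const card_ord; apply: (card2_neq0 (F2 e)).
  have c2 := pchar_card2 (F2 e).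
  apply: (natr_neq0_coprime c2); apply: (coprime_card_pred c2).
  exact: prime_gt0.
exists (s0 + (1 - s0.[1]) *: S) => [|_].
  by rewrite rmorphD /= linearZ /= bS scaler0 addr0 zs0.
by rewrite hornerD hornerZ S1 mulr1 addrC subrK.
Qed.

End Disconnected.

(** * Connectedness criteria and the classification over all finite fields *)

Section Main.

Variables (F : finFieldType) (n : nat).

Lemma connected_of_prime_order (T : 'M[F]_n.+1) :
  (forall X s, nsunit X -> prime s -> is_scalar_mx (X ^+ s) -> linked X T) ->
  connected_reduced_power_graph (PGL n.+1 F).
Proof.
move=> lT; apply: (@connected_of_linked _ _ T) => A /linked_prime[B [s [s_pr Bs lAB]]].
by have [_ nsB _] := lAB; apply: linked_trans lAB (lT _ _ nsB s_pr Bs).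
Qed.

Lemma connected_gt2 p : p \in [pchar F] -> (2 < #|F|)%N -> (3 <= n)%N -> (p <= n)%N ->
  ~~ prime n.+1 -> (prime #|F|.-1 -> (#|F| <= n.+1)%N) ->
  connected_reduced_power_graph (PGL n.+1 F).
Proof.
move=> charFp F3 n3 pn npn Fn; have [T hubT] := hub_of_card_gt2 charFp F3 n3 pn.
by apply: (@connected_of_prime_order T) => X s; apply: (linked_hub_gt2 charFp hubT).
Qed.

Lemma connected_card2 : #|F| = 2%N -> (8 <= n)%N -> ~~ prime n.+1 -> ~~ prime n ->
  (forall d, prime d -> prime (2 ^ d).-1 -> (d %| n.+1)%N -> ((2 ^ d).-1 <= n.+1)%N) ->
  (forall d, prime d -> prime (2 ^ d).-1 -> (d %| n)%N -> ((2 ^ d).-1 <= n)%N) ->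
  connected_reduced_power_graph (PGL n.+1 F).
Proof.
move=> F2 n8 npn npn' case2 case3; have charF2 := pchar_card2 F2.
have [T hubT] := hub_of_card2 charF2 F2 (ltnW n8).
by apply: (@connected_of_prime_order T) => X s; apply: (linked_hub_card2 charF2 hubT).
Qed.

End Main.

Local Close Scope ring_scope.

Theorem corollary1p4 (n q : nat) (F : finFieldType)
    (n_ge2 : 2 <= n) (cardF : #|F| = q) :
  [/\ (* (a) *)
      forall p : nat, p \in [pchar F]%R -> odd p ->
        (connected_reduced_power_graph (PGL n F) <->
           ~~ prime n /\ p < n),
      (* (b) *)
      2 \in [pchar F]%R -> q <> 2 ->
        (connected_reduced_power_graph (PGL n F) <->
           [/\ ~~ prime n, 2 < n & ~~ prime (q - 1) \/ q <= n])
    & (* (c) *)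
      q = 2 ->
        (~ connected_reduced_power_graph (PGL n F) <->
           [\/ prime n \/ prime (n - 1),
               exists p1 : nat,
                 [/\ prime p1, p1 %| n, prime (2 ^ p1 - 1)
                   & n <= 2 ^ p1 - 2]
             | exists p1 : nat,
                 [/\ prime p1, p1 %| n - 1, prime (2 ^ p1 - 1)
                   & n <= 2 ^ p1 - 1]])].
Proof.
case: n n_ge2 => [|n] // n0; rewrite ltnS in n0; subst q.
have q1 := finNzRing_gt1 F.
have not_prime : connected_reduced_power_graph (PGL n.+1 F) -> ~~ prime n.+1.
  by move=> con; apply/negP => pn; apply: (@disconnected_prime_degree F n false) con; rewrite ?subn0.
have n3 : ~~ prime n.+1 -> 3 <= n.
  by case: n n0 {not_prime} => [|[|[|m]]].
split=> [p charFp oddp | charF2 /eqP q2 | q2].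
- have p_pr := pcharf_prime charFp; have pF := dvdn_pchar_card charFp.
  have p3 : 2 < p by rewrite odd_prime_gt2.
  split=> [con | [np pn]].
    split; first exact: not_prime.
    rewrite ltnNge; apply/negP => np.
    by apply: (@disconnected_unipotent F n p charFp _) con; rewrite n0.
  apply: (connected_gt2 charFp) => //; first by rewrite (leq_trans p3) // dvdn_leq // ltnW.
    exact: n3.
  (* For odd [q], a prime [q - 1] is 2. *)
  move=> q_pr; suff -> : #|F| = 3 by rewrite ltnS ltnW // n3.
  have [e Fe] := p_natP (card_pnat charFp).
  have [q'2|q'_odd] := even_prime q_pr; first by rewrite -(prednK (ltnW q1)) q'2.
  have : odd #|F| by rewrite Fe oddX oddp orbT.
  by rewrite -(prednK (ltnW q1)) /= q'_odd.
- have q3 : 2 < #|F| by rewrite ltn_neqAle eq_sym q2.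
  rewrite subn1; split=> [con | [np n2 qn]].
    split; first exact: not_prime.
      by rewrite ltnW // ltnS n3 // not_prime.
    have [q_pr|] := boolP (prime #|F|.-1); last by left.
    right; rewrite leqNgt; apply/negP => nq.
    exact: disconnected_linear_factors con.
  apply: (connected_gt2 charF2) => //; first exact: n3.
  by move=> q_pr; case: qn => //; rewrite q_pr.
have eq2 d : 2 ^ d - 1 = (2 ^ d).-1 by rewrite subn1.
rewrite subn1 /=; split=> [ncon | ]; last first.
  case=> [[n_pr | n_pr] | [d [d_pr dn d_mers n_le]] | [d [d_pr dn d_mers n_le]]].
  - by move/not_prime; rewrite n_pr.
  - by apply: (@disconnected_prime_degree F n true); rewrite ?subn1.
  - rewrite eq2 in d_mers; apply: (@disconnected_mersenne F n d false) => //; rewrite subn0 //.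
    by have := prime_gt1 d_mers; move: n_le; clear; move: (2 ^ d); lia.
  rewrite eq2 in d_mers n_le; apply: (@disconnected_mersenne F n d true) => //; rewrite subn1 //.
have [n_pr | np] := boolP (prime n.+1); first by do 2 constructor.
have [n_pr | np'] := boolP (prime n); first by constructor; right.
pose P m k d := [&& prime d, d %| m, prime (2 ^ d - 1) & n.+1 <= 2 ^ d - k].
(* A candidate [d] divides [m], hence is at most [m], so the search is finite. *)
have dec m k : 0 < m -> (exists d, P m k d) \/ (forall d, ~~ P m k d).
  move=> m0; have [/existsP[d Pd]|/existsPn noP] := boolP [exists d : 'I_m.+1, P m k d].
    by left; exists d.
  right=> d; apply/negP => Pd; have /and4P[_ dm _ _] := Pd.
  have dm' : d < m.+1 by rewrite ltnS dvdn_leq.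
  by have /negP := noP (Ordinal dm').
have [[d /and4P[]] | no2] := dec n.+1 2 isT; first by constructor 2; exists d.
have [[d /and4P[]] | no3] := dec n 1 n0; first by constructor 3; exists d.
case: ncon; apply: connected_card2 => //.
(* For [n] from 1 to 7, one of [n] and [n.+1] is prime, so [8 <= n]. *)
- move: np np' n0; clear.
  by case: n => [|[|[|[|[|[|[|[|m]]]]]]]].
- move=> d d_pr s_pr dn; have := no2 d; rewrite /P d_pr dn eq2 s_pr /= -ltnNge.
  by move: (2 ^ d); clear; lia.
move=> d d_pr s_pr dn; have := no3 d; rewrite /P d_pr dn eq2 s_pr /= -ltnNge.
by rewrite ltnS.
Qed.
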